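(* Let $K$ be a finite extension of $\mathbf{Q}_p$ with ring of integers $\mathcal{O}$, let $\Lambda=\mathcal{O}[\![T]\!]$, and let $M$ be the integral closure of $\Lambda$ in a finite extension of $\mathrm{Frac}(\Lambda)$. Suppose we are given: an element $F\in M$; an integer $B\geq0$; an infinite set $S\subset\mu_{p^\infty}$; for each $\zeta\in S$ a $\overline{\mathbf{Q}}_p$-point $P_\zeta$ of $M$ extending the point $T\mapsto\zeta-1$ of $\Lambda$; a root of unity $\xi$; and coefficients $c_1,\dots,c_B\in\mathbf{Z}[\xi]$; such that for each $\zeta\in S$ we have $F(P_\zeta)\in\mathbf{Z}[\xi,\zeta]$ and \[F(P_\zeta)=\sum_{i=1}^{B}c_i\zeta^{e_{\zeta,i}}\] for some integer exponents $e_{\zeta,i}$. Then there are a root of unity $\xi'$, coefficients $d_1,\dots,d_B\in\mathbf{Z}[\xi']$ and exponents $e_1,\dots,e_B\in\mathbf{Z}_p$ such that $F\in\Lambda[\xi']$ and \[F=\sum_{i=1}^{B}d_i(1+T)^{e_i}.\]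
   Context: A $\overline{\mathbf{Q}}_p$-point of $M$ is a ring homomorphism $P:M\to\overline{\mathbf{Q}}_p$; it extends the point $T\mapsto t$ of $\Lambda$ if its restriction to $\Lambda$ is the $\mathcal{O}$-algebra map sending $T$ to $t$. One writes $F(P)$ for $P(F)$. For $e\in\mathbf{Z}_p$, $(1+T)^e=\sum_{n\ge0}\binom{e}{n}T^n\in\mathbf{Z}_p[\![T]\!]$, where $\binom{e}{n}=e(e-1)\cdots(e-n+1)/n!$. *)

(* Defs.v *)
From HB Require Import structures.
From mathcomp Require Import all_boot all_order all_algebra all_field.
From mathcomp Require Import boolp classical_sets functions cardinality.

Set Implicit Arguments.
Unset Strict Implicit.
Unset Printing Implicit Defensive.

Import GRing.Theory.
Local Open Scope ring_scope.

(* A commutative domain, with units and inverses obtained by classical choice *)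
HB.factory Record ComNzRing_isClassicalDomain R of GRing.ComNzRing R := {
  classical_mulf_eq0 : forall x y : R, x * y = 0 -> (x == 0) || (y == 0)
}.

HB.builders Context R of ComNzRing_isClassicalDomain R.

Definition has_inv : {pred R} := fun x => `[< exists y : R, y * x = 1 >].

Definition classical_inv (x : R) : R :=
  if pselect (exists y : R, y * x = 1) is left ex_y then sval (cid ex_y) else x.

Fact classical_mulVx : {in has_inv, left_inverse 1 classical_inv *%R}.
Proof.
move=> x /asboolP x_inv; rewrite /classical_inv.
by case: pselect => // ex_y; case: (cid ex_y).
Qed.

Fact classical_unitPl (x y : R) : y * x = 1 -> has_inv x.
Proof. by move=> yx1; apply/asboolP; exists y. Qed.

Fact classical_inv_out : {in [predC has_inv], classical_inv =1 id}.
Proof.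
move=> x /negP x_ninv; rewrite /classical_inv; case: pselect => // ex_y.
by case: x_ninv; apply/asboolP.
Qed.

HB.instance Definition _ := GRing.ComNzRing_hasMulInverse.Build R
  classical_mulVx classical_unitPl classical_inv_out.
HB.instance Definition _ := GRing.ComUnitRing_isIntegral.Build R
  classical_mulf_eq0.
HB.end.

(* Z_p is the inverse limit of the Z/p^n, the class of x in Z/p^n being       *)
(* represented by its least nonnegative member [residue x n].                 *)
Section PadicInt.
Variables (p : nat) (p_pr : prime p).

Definition coherent : pred (nat -> nat) :=
  fun f => `[< forall n, f n = (f n.+1 %% p ^ n)%N >].

Record padic_int (pr : prime p) :=
  PadicInt { residue :> nat -> nat; _ : coherent residue }.

Local Notation Zp := (padic_int p_pr).

HB.instance Definition _ := [isSub for @residue p_pr].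
HB.instance Definition _ := [Choice of Zp by <:].

Implicit Types x y z : Zp.

Lemma residueS x n : (x n.+1 %% p ^ n)%N = x n.
Proof. by case: x => f /= /asboolP/(_ n). Qed.

Lemma residueK x n : (x n %% p ^ n)%N = x n.
Proof. by rewrite -residueS modn_mod. Qed.

Lemma residueD x n k : (x (n + k)%N %% p ^ n)%N = x n.
Proof.
elim: k => [|k IHk]; first by rewrite addn0 residueK.
by rewrite addnS -[RHS]IHk -(residueS x (n + k)) modn_dvdm // dvdn_exp2l ?leq_addr.
Qed.

Lemma padicP x y : (forall n, x n = y n) -> x = y.
Proof. by move=> eq_xy; apply/val_inj/funext. Qed.

Fact padic_of_subproof (f : nat -> nat) :
  (forall n, f n.+1 = f n %[mod p ^ n]) -> coherent (fun n => f n %% p ^ n)%N.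
Proof.
move=> f_coh; apply/asboolP => n.
by rewrite modn_dvdm ?dvdn_exp2l // f_coh.
Qed.

Definition padic_of f f_coh : Zp := PadicInt p_pr (@padic_of_subproof f f_coh).

Fact padic_nat_subproof (m n : nat) : m = m %[mod p ^ n]. Proof. by []. Qed.
Definition padic_nat m : Zp := padic_of (padic_nat_subproof m).

Fact padic_add_subproof x y n : (x n.+1 + y n.+1 = x n + y n %[mod p ^ n])%N.
Proof. by rewrite -modnDm !residueS. Qed.
Definition padic_add x y : Zp := padic_of (padic_add_subproof x y).

Fact padic_mul_subproof x y n : (x n.+1 * y n.+1 = x n * y n %[mod p ^ n])%N.
Proof. by rewrite -modnMm !residueS. Qed.
Definition padic_mul x y : Zp := padic_of (padic_mul_subproof x y).

Lemma residue_le x n : (x n <= p ^ n)%N.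
Proof. by rewrite -residueK ltnW // ltn_mod expn_gt0 prime_gt0. Qed.

Fact padic_opp_subproof x n : (p ^ n.+1 - x n.+1 = p ^ n - x n %[mod p ^ n])%N.
Proof.
apply/eqP; rewrite -(eqn_modDr (x n.+1)) subnK ?residue_le //.
rewrite -(modnDmr (p ^ n - x n)) residueS subnK ?residue_le //.
by rewrite modnn expnS modnMl.
Qed.
Definition padic_opp x : Zp := padic_of (padic_opp_subproof x).

Fact padic_addA : associative padic_add.
Proof. by move=> x y z; apply: padicP => n /=; rewrite modnDmr modnDml addnA. Qed.
Fact padic_addC : commutative padic_add.
Proof. by move=> x y; apply: padicP => n /=; rewrite addnC. Qed.
Fact padic_add0 : left_id (padic_nat 0) padic_add.
Proof. by move=> x; apply: padicP => n /=; rewrite mod0n add0n residueK. Qed.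
Fact padic_addN : left_inverse (padic_nat 0) padic_opp padic_add.
Proof.
by move=> x; apply: padicP => n /=; rewrite modnDml subnK ?residue_le // modnn mod0n.
Qed.

HB.instance Definition _ := GRing.isZmodule.Build Zp
  padic_addA padic_addC padic_add0 padic_addN.

Fact padic_mulA : associative padic_mul.
Proof. by move=> x y z; apply: padicP => n /=; rewrite modnMmr modnMml mulnA. Qed.
Fact padic_mulC : commutative padic_mul.
Proof. by move=> x y; apply: padicP => n /=; rewrite mulnC. Qed.
Fact padic_mul1 : left_id (padic_nat 1) padic_mul.
Proof. by move=> x; apply: padicP => n /=; rewrite modnMml mul1n residueK. Qed.
Fact padic_mulDl : left_distributive padic_mul +%R.
Proof.
by move=> x y z; apply: padicP => n /=; rewrite modnMml modnDm mulnDl.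
Qed.
Fact padic_1neq0 : padic_nat 1 != 0.
Proof.
apply/eqP => /(congr1 (fun x : Zp => x 1%N)) /=.
by rewrite expn1 mod0n modn_small ?prime_gt1.
Qed.

HB.instance Definition _ := GRing.Zmodule_isComNzRing.Build Zp
  padic_mulA padic_mulC padic_mul1 padic_mulDl padic_1neq0.

Lemma residue_add x y n : (x + y) n = ((x n + y n) %% p ^ n)%N.
Proof. by []. Qed.

Lemma residue0 n : (0 : Zp) n = 0%N.
Proof. by rewrite [LHS]/= mod0n. Qed.

Lemma residue_mul x y n : (x * y) n = ((x n * y n) %% p ^ n)%N.
Proof. by []. Qed.

Lemma residue_padic_of f f_coh n : @padic_of f f_coh n = (f n %% p ^ n)%N.
Proof. by []. Qed.

Lemma residue_nat m n : (m%:R : Zp) n = (m %% p ^ n)%N.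
Proof.
elim: m => [|m IHm] //.
by rewrite -addn1 natrD residue_add IHm [(1%:R : Zp) n]/= modnDml modnDmr.
Qed.

Lemma padic_nat_neq0 m : (0 < m)%N -> m%:R != 0 :> Zp.
Proof.
move=> m_gt0; apply/eqP => m0; have := residue_nat m m.
rewrite m0 residue0 modn_small => [m_eq0|]; first by rewrite -m_eq0 in m_gt0.
exact/ltn_expl/prime_gt1.
Qed.

Lemma padic_neq0P x : x <> 0 -> exists n, x n != 0%N.
Proof.
move=> x_neq0; apply: contrapT => x_eq0; apply: x_neq0.
apply: padicP => n; rewrite residue0.
by apply: contrapT => /eqP xn; apply: x_eq0; exists n.
Qed.

Fact padic_mulf_eq0 x y : x * y = 0 -> (x == 0) || (y == 0).
Proof.
move=> xy0; apply/orP; apply: contrapT => /not_orP [/negP/eqP x0 /negP/eqP y0].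
have [n xn] := padic_neq0P x0; have [m ym] := padic_neq0P y0.
have /esym/eqP := residue_mul x y (n + m); rewrite xy0 residue0 -/(dvdn _ _).
have nx : ~~ (p ^ n %| x (n + m)%N)%N by rewrite /dvdn residueD.
have my : ~~ (p ^ m %| y (n + m)%N)%N by rewrite /dvdn addnC residueD.
have x_gt0 : (0 < x (n + m)%N)%N by case: (x _) nx; rewrite ?dvdn0.
have y_gt0 : (0 < y (n + m)%N)%N by case: (y _) my; rewrite ?dvdn0.
rewrite pfactor_dvdn ?muln_gt0 ?x_gt0 //= lognM //.
rewrite pfactor_dvdn // -ltnNge in nx; rewrite pfactor_dvdn // -ltnNge in my.
by rewrite leqNgt (leq_trans _ (leq_add nx (ltnW my))) // -addSn leq_add.
Qed.

HB.instance Definition _ := ComNzRing_isClassicalDomain.Build Zp padic_mulf_eq0.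

End PadicInt.

Arguments residue : simpl never.

Notation padic p_pr := {fraction (padic_int p_pr)}.

Section PadicBinomial.
Variables (p : nat) (p_pr : prime p).
Local Notation Zp := (padic_int p_pr).
Implicit Types (e : Zp) (n : nat).

Definition padic_binom e n : padic p_pr :=
  (\prod_(i < n) (tofrac e - i%:R)) / n`!%:R.

Lemma residue_ffact e n k v :
  (\prod_(i < n) (e - i%:R)) k = (e (k + v)%N ^_ n %% p ^ k)%N.
Proof.
elim: n => [|n IHn]; first by rewrite big_ord0 ffactn0.
rewrite big_ord_recr /= residue_mul IHn ffactnSr.
have [lt_mn|le_nm] := ltnP (e (k + v)%N) n.
  by rewrite ffact_small // !mul0n mod0n mul0n mod0n.
rewrite -[RHS]modnMm -[LHS]modnMm modn_mod; congr (_ * _ %% _)%N.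
apply/eqP; rewrite -(eqn_modDr n) subnK //; apply/eqP.
rewrite residueD -modnDmr -(residue_nat p_pr n) -residue_add.
by rewrite subrK.
Qed.

Lemma padic_fact_dvd e n :
  exists b : Zp, n`!%:R * b = \prod_(i < n) (e - i%:R).
Proof.
pose v := logn p n`!.
have bP k : 'C(e (k.+1 + v)%N, n) = 'C(e (k + v)%N, n) %[mod p ^ k].
  have [m co_m def_n] := pfactor_coprime p_pr (fact_gt0 n).
  have : ('C(e (k.+1 + v), n) * n`! = 'C(e (k + v), n) * n`! %[mod p ^ (k + v)])%N.
    have eq_e i : (e (k.+1 + v) ^_ i = e (k + v) ^_ i %[mod p ^ (k + v)])%N.
      have := residue_ffact e i (k + v) 0.
      by rewrite (residue_ffact e i (k + v) 1) addn0 addn1 addSn.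
    by rewrite !bin_ffact.
  rewrite def_n -/v !mulnA expnD.
  move=> /eqP; rewrite -!muln_modl eqn_pmul2r ?expn_gt0 ?prime_gt0 //.
  have co_pm : coprime (p ^ k) m by rewrite coprimeXl.
  move=> eq_m; apply/eqP; move: eq_m.
  set a := 'C(_, _); set b := 'C(_, _).
  wlog le_ba : a b / (b <= a)%N => [hwlog|].
    have [/hwlog//|/ltnW/hwlog hw] := leqP b a.
    by rewrite eq_sym => /hw; rewrite eq_sym.
  by rewrite !eqn_mod_dvd ?leq_mul2r ?le_ba ?orbT // -mulnBl Gauss_dvdl.
exists (padic_of p_pr bP); apply: padicP => k.
rewrite residue_mul residue_nat residue_padic_of modnMml modnMmr mulnC bin_ffact.
by rewrite (residue_ffact e n k v).
Qed.

Lemma padic_binom_int e n : exists b : Zp, tofrac b = padic_binom e n.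
Proof.
have [b def_b] := padic_fact_dvd e n; exists b.
have nf0 : n`!%:R != 0 :> padic p_pr.
  by rewrite -(rmorph_nat (@tofrac Zp)) tofrac_eq0 padic_nat_neq0 ?fact_gt0.
apply: (mulfI nf0); rewrite /padic_binom mulrC [RHS]mulrC divfK // mulrC.
rewrite -[X in X * _](rmorph_nat (@tofrac Zp)) -rmorphM def_b rmorph_prod.
by apply: eq_bigr => i _; rewrite rmorphB rmorph_nat.
Qed.

Definition padic_int_binom e n : Zp := sval (cid (padic_binom_int e n)).

Lemma padic_int_binomE e n : tofrac (padic_int_binom e n) = padic_binom e n.
Proof. by rewrite /padic_int_binom; case: (cid _). Qed.

End PadicBinomial.

Section PowerSeries.
Variable R : comNzRingType.

(* A record, so as not to inherit the pointwise product on functions *)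
Record power_series := PowerSeries { coefps : nat -> R }.

HB.instance Definition _ := [isNew for coefps].
HB.instance Definition _ := [Choice of power_series by <:].

Implicit Types f g h : power_series.

Lemma power_seriesP f g : (forall n, coefps f n = coefps g n) -> f = g.
Proof. by move=> eq_fg; apply/val_inj/funext. Qed.

Definition ps_const (c : R) := PowerSeries (fun n => if n is 0%N then c else 0).
Definition ps_var := PowerSeries (fun n => (n == 1%N)%:R).
Definition ps_opp f := PowerSeries (fun n => - coefps f n).
Definition ps_add f g := PowerSeries (fun n => coefps f n + coefps g n).
Definition ps_mul f g :=
  PowerSeries (fun n => \sum_(i < n.+1) coefps f i * coefps g (n - i)%N).

Fact ps_addA : associative ps_add.
Proof. by move=> f g h; apply: power_seriesP => n /=; rewrite addrA. Qed.
Fact ps_addC : commutative ps_add.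
Proof. by move=> f g; apply: power_seriesP => n /=; rewrite addrC. Qed.
Fact ps_add0 : left_id (ps_const 0) ps_add.
Proof. by move=> f; apply: power_seriesP => -[|n] /=; rewrite add0r. Qed.
Fact ps_addN : left_inverse (ps_const 0) ps_opp ps_add.
Proof. by move=> f; apply: power_seriesP => -[|n] /=; rewrite addNr. Qed.

HB.instance Definition _ := GRing.isZmodule.Build power_series
  ps_addA ps_addC ps_add0 ps_addN.

Let trunc N f : {poly R} := \poly_(i < N.+1) coefps f i.

Let coef_trunc N f n : (n <= N)%N -> (trunc N f)`_n = coefps f n.
Proof. by move=> le_nN; rewrite coef_poly ltnS le_nN. Qed.

Let coef_truncM N f g n :
  (n <= N)%N -> coefps (ps_mul f g) n = (trunc N f * trunc N g)`_n.
Proof.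
move=> le_nN; rewrite coefM; apply: eq_bigr => i _.
rewrite !coef_trunc //; first exact: leq_trans (leq_subr _ _) le_nN.
by rewrite (leq_trans _ le_nN) // -ltnS.
Qed.

Fact ps_mulC : commutative ps_mul.
Proof.
by move=> f g; apply: power_seriesP => n; rewrite !(@coef_truncM n) // mulrC.
Qed.

Fact ps_mulA : associative ps_mul.
Proof.
move=> f g h; apply: power_seriesP => n.
have -> : coefps (ps_mul f (ps_mul g h)) n
        = (trunc n f * (trunc n g * trunc n h))`_n.
  rewrite coefM; apply: eq_bigr => i _.
  by rewrite coef_trunc ?(@coef_truncM n) ?leq_subr // -ltnS.
have -> : coefps (ps_mul (ps_mul f g) h) n
        = ((trunc n f * trunc n g) * trunc n h)`_n.
  rewrite coefM; apply: eq_bigr => i _.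
  by rewrite coef_trunc ?(@coef_truncM n) ?leq_subr // -ltnS.
by rewrite mulrA.
Qed.

Fact ps_mul1 : left_id (ps_const 1) ps_mul.
Proof.
move=> f; apply: power_seriesP => n /=.
rewrite big_ord_recl /= mul1r subn0 big1 ?addr0 // => i _.
by rewrite mul0r.
Qed.

Fact ps_mulDl : left_distributive ps_mul +%R.
Proof.
move=> f g h; apply: power_seriesP => n /=.
by rewrite -big_split; apply: eq_bigr => i _; rewrite mulrDl.
Qed.

Fact ps_1neq0 : ps_const 1 != 0.
Proof.
by apply/eqP => /(congr1 (coefps^~ 0%N)) /= /eqP; rewrite oner_eq0.
Qed.

HB.instance Definition _ := GRing.Zmodule_isComNzRing.Build power_series
  ps_mulA ps_mulC ps_mul1 ps_mulDl ps_1neq0.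

Lemma coefps0 n : coefps 0 n = 0. Proof. by case: n. Qed.
Lemma coefpsD f g n : coefps (f + g) n = coefps f n + coefps g n.
Proof. by []. Qed.
Lemma coefpsM f g n :
  coefps (f * g) n = \sum_(i < n.+1) coefps f i * coefps g (n - i)%N.
Proof. by []. Qed.

End PowerSeries.

Section PowerSeriesDomain.
Variable R : idomainType.

Fact ps_mulf_eq0 (f g : power_series R) : f * g = 0 -> (f == 0) || (g == 0).
Proof.
have lead (h : power_series R) : h <> 0 ->
    exists2 n, coefps h n != 0 & forall m, (m < n)%N -> coefps h m = 0.
  move=> h_neq0; have ex_n : exists n, coefps h n != 0.
    apply: contrapT => h_eq0; apply: h_neq0; apply: power_seriesP => n.
    rewrite coefps0; apply: contrapT => /eqP hn; apply: h_eq0; by exists n.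
  case: (ex_minnP ex_n) => n hn n_min; exists n => // m lt_mn.
  by apply/eqP; apply: contraLR lt_mn => /n_min; rewrite -leqNgt.
move=> fg0; apply/orP; apply: contrapT => /not_orP [/negP/eqP f0 /negP/eqP g0].
have [m fm f_m] := lead f f0; have [n gn g_n] := lead g g0.
have /eqP := congr1 (fun h => coefps h (m + n)%N) fg0.
rewrite coefpsM coefps0.
have lt_m : (m < (m + n).+1)%N by rewrite ltnS leq_addr.
rewrite (bigD1 (Ordinal lt_m)) //= addKn big1 ?addr0 => [|i].
  by rewrite mulf_eq0 (negPf fm) (negPf gn).
rewrite -val_eqE /= neq_ltn => /orP[/f_m->|lt_mi]; first by rewrite mul0r.
rewrite g_n ?mulr0 //.
by rewrite ltn_subLR ?ltn_add2r // -ltnS.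
Qed.

HB.instance Definition _ := ComNzRing_isClassicalDomain.Build (power_series R)
  ps_mulf_eq0.

End PowerSeriesDomain.

Definition map_ps (R S : comNzRingType) (f : R -> S) (g : power_series R) :=
  PowerSeries (fun n => f (coefps g n)).

Definition one_plus_T_pow p (p_pr : prime p) (e : padic_int p_pr) :
    power_series (padic_int p_pr) :=
  PowerSeries (padic_int_binom e).

Section IntegralClosure.
Variables (R : comNzRingType) (E : fieldType) (f : {rmorphism R -> E}).

Definition integral_over_pred : {pred E} := fun x => `[< integralOver f x >].

Record integral_closure :=
  IntegralClosure { icval :> E; _ : icval \in integral_over_pred }.

HB.instance Definition _ := [isSub for icval].
HB.instance Definition _ := [Choice of integral_closure by <:].

Fact integral_subring_closed : subring_closed integral_over_pred.
Proof.
split=> [|x y /asboolP intx /asboolP inty|x y /asboolP intx /asboolP inty].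
- exact/asboolP/integral1.
- exact/asboolP/integral_sub.
- exact/asboolP/integral_mul.
Qed.

HB.instance Definition _ := GRing.SubChoice_isSubComNzRing.Build
  E integral_over_pred integral_closure integral_subring_closed.

Fact ic_mulf_eq0 (x y : integral_closure) : x * y = 0 -> (x == 0) || (y == 0).
Proof.
move=> /(congr1 val)/eqP; rewrite rmorphM rmorph0 mulf_eq0.
by rewrite -!(inj_eq val_inj) rmorph0.
Qed.

HB.instance Definition _ := ComNzRing_isClassicalDomain.Build integral_closure
  ic_mulf_eq0.

Fact ic_in_subproof (r : R) : f r \in integral_over_pred.
Proof. exact/asboolP/integral_id. Qed.

Definition ic_in (r : R) : integral_closure := IntegralClosure (ic_in_subproof r).

Fact ic_in_is_zmod_morphism : zmod_morphism ic_in.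
Proof. by move=> r s; apply: val_inj; rewrite /= rmorphB. Qed.
Fact ic_in_is_monoid_morphism : monoid_morphism ic_in.
Proof. by split=> [|r s]; apply: val_inj; rewrite /= ?rmorph1 ?rmorphM. Qed.
HB.instance Definition _ := GRing.isZmodMorphism.Build R integral_closure ic_in
  ic_in_is_zmod_morphism.
HB.instance Definition _ := GRing.isMonoidMorphism.Build R integral_closure ic_in
  ic_in_is_monoid_morphism.

End IntegralClosure.

(* The structural map from a domain to a field extension of its field of      *)
(* fractions                                                                  *)
Definition frac_alg (R : idomainType) (E : fieldExtType {fraction R}) :
    {rmorphism R -> E} :=
  (in_alg E \o @tofrac R : {rmorphism R -> E}).

Section Setup.
Variables (p : nat) (p_pr : prime p) (K : fieldExtType (padic p_pr)).

(* O is the integral closure of Z_p in K. *)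
Definition ring_of_integers := integral_closure (frac_alg K).
HB.instance Definition _ := GRing.IntegralDomain.on ring_of_integers.
Definition Lambda := power_series ring_of_integers.
HB.instance Definition _ := GRing.IntegralDomain.on Lambda.

Definition Lambda_pow (e : padic_int p_pr) : Lambda :=
  map_ps (@ic_in _ _ (frac_alg K)) (one_plus_T_pow e).

Variable L : fieldExtType {fraction Lambda}.

Definition iclosure_Lambda := integral_closure (frac_alg L).
HB.instance Definition _ := GRing.IntegralDomain.on iclosure_Lambda.

(* Weierstrass division shows that there is at most one O-algebra map from    *)
(* Lambda to the algebraic closure sending T to t, for t algebraic with       *)
(* |t| < 1, so that these conditions determine the restriction of P to Lambda *)
Definition extends_point (Qpbar : fieldType) (iota : {rmorphism K -> Qpbar})
    (P : {rmorphism iclosure_Lambda -> Qpbar}) (t : Qpbar) :=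
  (forall a : ring_of_integers, P (ic_in (frac_alg L) (ps_const a)) = iota (val a)) /\
  P (ic_in (frac_alg L) (ps_var ring_of_integers)) = t.

End Setup.

Definition is_root_of_unity (E : fieldType) (x : E) :=
  exists2 n, (0 < n)%N & n.-unity_root x.

Definition p_power_roots_of_unity (p : nat) (E : fieldType) : set E :=
  [set x | exists n, (p ^ n)%N.-unity_root x].
Arguments p_power_roots_of_unity p E : clear implicits.

(* R[x] inside E, for a structural map f : R -> E *)
Definition adjoin1 (R E : nzRingType) (f : R -> E) (x : E) : set E :=
  [set y | exists q : {poly R}, y = (map_poly f q).[x]].

Definition Zadjoin (E : nzRingType) (x : E) : set E := adjoin1 (intr : int -> E) x.

Definition Zadjoin2 (E : nzRingType) (x y : E) : set E :=
  [set z | exists q : {poly {poly int}},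
    z = (map_poly (map_poly (intr : int -> E)) q).[x, y]].

Definition algebraic_closure (E : fieldType) (Ebar : closedFieldType)
    (f : {rmorphism E -> Ebar}) :=
  forall x : Ebar, algebraicOver f x.

(* Main.v *)
Require Import Defs.
From HB Require Import structures.
From mathcomp Require Import all_boot all_order all_algebra all_field.
From mathcomp Require Import cyclic ring zify.
From mathcomp Require Import boolp classical_sets functions cardinality.
From mathcomp Require Import generic_quotient ring_quotient filter.

(* The values of [F] at the [P_zeta] are read in an ultraproduct [KK] of copies of
   [Qpbar], along a nonprincipal ultrafilter on a sequence in [S]. There [Z_p[[T]]]
   embeds, since a nonzero power series kills only finitely many [zeta - 1], and the
   class of [F] is [\sum_i c_i X_i] with [X_i] the class of [zeta ^ e_(zeta,i)]; it is
   algebraic over [Z_p[[T]]] because [O] is, up to bounded denominators, a finite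
   [Z_p]-module. For some [d], every [a = 1 mod p ^ d] is realised by Galois
   automorphisms fixing [xi] and sending [zeta] to [zeta ^ a]; hence the power sums
   [\sum_i c_i X_i ^ a] are all algebraic over [Z_p[[T]]], and Prony's method shows
   that so is each [X_i] (those [X_i] whose contributions cancel are discarded).
   An algebraic [X = (zeta ^ e_zeta)] is a constant root of unity times [(1 + T) ^ e0],
   where [e0] is the limit of the [e_zeta] in [Z_p]: otherwise the quotient [Y] of [X]
   by [(1 + T) ^ e0] satisfies [|p| << |Y - 1| << |zeta - 1|] on infinitesimal scales,
   and no polynomial over [Z_p[[T]]] can vanish at it. Sizes are expressed by
   divisibility among integral elements of [Qpbar], so no absolute value is needed.
   Finally, a resultant eliminates the root of unity and transports the identity
   from the points to [Omega]. *)

Set Implicit Arguments.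
Unset Strict Implicit.
Unset Printing Implicit Defensive.

Import GRing.Theory.
Local Open Scope ring_scope.
Local Open Scope classical_set_scope.

(** * p-adic integers and fraction fields *)

(** Two obstacles shape the proof. The exponents [e_(zeta,i)] depend on [zeta] without any
    uniformity, so algebraicity is established for whole families. And the substitution
    [T |-> (1 + T) ^ a - 1], which mirrors [zeta |-> zeta ^ a], need not extend from [Lambda] to
    [M]: only the algebraic relation of [F] over [Z_p[[T]]] is conjugated, its coefficients
    undergoing the substitution and the value of [F] becoming a power sum. The progression
    [a = 1 mod p ^ d] comes from [xi], whose order [m0] may be divisible by [p]: an automorphism
    raised to the power [totient m0] fixes [xi], and [1 + p ^ d Z_p] consists of such powers for
    large [d]. Along it the power sums read [\sum_i (c_i X_i) (X_i ^ (p ^ d)) ^ m], the shape that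
    Prony's method requires. The [P_zeta] are bare ring morphisms: their values on [Z_p[[T]]] are
    reached by Weierstrass division, not by convergence. The roots of unity so found lie in [Qpbar],
    with no map given to [Omega]; hence the final elimination. *)

Lemma subf_div (F : fieldType) (a b c d : F) : b != 0 -> d != 0 ->
  a / b - c / d = (a * d - c * b) / (b * d).
Proof. by move=> b0 d0; rewrite -mulNr addf_div // mulNr. Qed.

Lemma expf_ratio (F : fieldType) (P u v : F) m n : P != 0 -> v != 0 -> (n <= m)%N ->
  (P ^+ m * u) / (P ^+ n * v) = u / v * P ^+ (m - n).
Proof.
move=> P0 v0 le; rewrite -{1}(subnK le) exprD.
have := expf_neq0 n P0; move: (P ^+ n) (P ^+ (m - n)) => Q Q' Q0.
by field; apply/andP.
Qed.

Section PadicFacts.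
Variables (p : nat) (p_pr : prime p).
Local Notation Zp := (padic_int p_pr).
Implicit Types x y z : Zp.

Lemma residue_natX N n : ((p%:R : Zp) ^+ N) n = (p ^ N %% p ^ n)%N.
Proof. by rewrite -natrX residue_nat. Qed.

Lemma padic_residue_le x m n : (m <= n)%N -> (x n %% p ^ m)%N = x m.
Proof. by move=> le_mn; rewrite -(subnKC le_mn) residueD. Qed.

Lemma padic_pX_dvd x N : x N = 0%N -> exists y, x = p%:R ^+ N * y.
Proof.
move=> xN0.
have pN_gt0 : (0 < p ^ N)%N by rewrite expn_gt0 prime_gt0.
have dvd n : (p ^ N %| x (n + N))%N.
  by rewrite /dvdn (padic_residue_le _ (leq_addl n N)) xN0.
have coh n : (x (n.+1 + N) %/ p ^ N = x (n + N) %/ p ^ N %[mod p ^ n])%N.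
  apply/eqP; rewrite -(eqn_pmul2r pN_gt0) !muln_modl ?divnK // -expnD.
  by rewrite addSn residueS residueK.
exists (padic_of p_pr coh); apply: padicP => n.
rewrite residue_mul residue_natX residue_padic_of modnMm.
by rewrite mulnC divnK // padic_residue_le ?leq_addr.
Qed.

Lemma padic_pXM0 y N : (p%:R ^+ N * y) N = 0%N.
Proof. by rewrite residue_mul residue_natX modnn mul0n mod0n. Qed.

Lemma padic_pXMS y N : ((p%:R ^+ N * y) N.+1 == 0%N) = (y 1 == 0%N).
Proof.
rewrite residue_mul residue_natX modnMml -/(dvdn _ _) expnSr dvdn_pmul2l.
  rewrite -(padic_residue_le y (ltn0Sn N)) expn1 /dvdn.
  by [].
by rewrite expn_gt0 prime_gt0.
Qed.

Lemma padic_unit x : x 1 != 0%N -> exists y, x * y = 1.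
Proof.
move=> x1.
have co n : coprime (x n.+1) (p ^ n.+1).
  rewrite coprime_sym coprime_pexpl // prime_coprime // /dvdn.
  by have := padic_residue_le x (ltn0Sn n); rewrite expn1 => ->.
have inv n : (x n * x n ^ (totient (p ^ n)).-1 = 1 %[mod p ^ n])%N.
  case: n => [|n]; first by rewrite expn0 !modn1.
  rewrite -expnS prednK ?totient_gt0 ?expn_gt0 ?prime_gt0 //.
  exact/Euler_exp_totient/co.
have coh n : (x n.+1 ^ (totient (p ^ n.+1)).-1 =
              x n ^ (totient (p ^ n)).-1 %[mod p ^ n])%N.
  case: n => [|n]; first by rewrite expn0 !modn1.
  set u := (x n.+2 ^ _)%N; set v := (x n.+1 ^ _)%N.
  have Hu : (x n.+1 * u = 1 %[mod p ^ n.+1])%N.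
    rewrite -(residueS x n.+1) modnMml.
    have /eqP := inv n.+2; rewrite -/u => /eqP H.
    by rewrite -[LHS](modn_dvdm _ (dvdn_exp2l p (leqnSn n.+1))) H modn_dvdm // dvdn_exp2l.
  have Hv : (x n.+1 * v = 1 %[mod p ^ n.+1])%N := inv n.+1.
  have -> : (u = u * (x n.+1 * v) %[mod p ^ n.+1])%N by rewrite -modnMmr Hv modnMmr muln1.
  by rewrite mulnA [(u * _)%N]mulnC -modnMml Hu modnMml mul1n.
exists (padic_of p_pr coh); apply: padicP => n.
by rewrite residue_mul residue_padic_of modnMmr inv -(residue_nat p_pr 1).
Qed.

Lemma padic_p_neq0 : p%:R != 0 :> Zp.
Proof. by rewrite padic_nat_neq0 ?prime_gt0. Qed.

(** Divides out the largest common power of [p]. The index type is left free so as to cover the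
    coefficients of a power series, and pairs of indices for a polynomial over power series. *)
Lemma padic_content (I : Type) (x : I -> Zp) : (exists i, x i != 0) ->
  exists mu (y : I -> Zp), (forall i, x i = p%:R ^+ mu * y i) /\
    exists i, y i 1 != 0%N.
Proof.
move=> [i0 xi0].
have ex_n : exists n, `[< exists i, x i n.+1 != 0%N >].
  have [n] := padic_neq0P (elimN eqP xi0).
  case: n => [|n xn]; last by exists n; apply/asboolP; exists i0.
  by rewrite -(residueK (x i0)) expn0 modn1.
case: (ex_minnP ex_n) => mu /asboolP[i xi] mu_min.
have x0 k : x k mu = 0%N.
  case: mu mu_min {xi} => [|mu] mu_min.
    by rewrite -residueK expn0 modn1.
  apply: contrapT => /eqP xk.
  have /mu_min : `[< exists i, x i mu.+1 != 0%N >] by apply/asboolP; exists k.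
  by rewrite ltnn.
have yP k := cid (padic_pX_dvd (x0 k)).
exists mu, (fun k => sval (yP k)); split=> [k|]; first by case: (yP k).
exists i; case: (yP i) => y /= def_x.
by rewrite -(padic_pXMS y mu) -def_x.
Qed.

Lemma padic_unit_decomp x : x != 0 -> exists mu u v, x = p%:R ^+ mu * u /\ u * v = 1.
Proof.
move=> x0; have [mu [y [def_x [[] y1]]]] := @padic_content unit (fun _ => x) (ex_intro _ tt x0).
have [v yv] := padic_unit y1.
by exists mu, (y tt), v; split => //; rewrite (def_x tt).
Qed.

Lemma padic_separated x : (forall N, exists y, x = p%:R ^+ N * y) -> x = 0.
Proof.
move=> H; apply: padicP => n; have [y ->] := H n.
by rewrite padic_pXM0 residue0.
Qed.

Lemma padic_psum (a : nat -> Zp) :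
  exists s, forall n, exists y, s = \sum_(i < n) p%:R ^+ i * a i + p%:R ^+ n * y.
Proof.
pose b n := \sum_(i < n) p%:R ^+ i * a i.
have coh n : (b n.+1 n.+1 = b n n %[mod p ^ n])%N.
  by rewrite residueS /b big_ord_recr /= residue_add padic_pXM0 addn0.
exists (padic_of p_pr coh) => n.
have [|y Hy] := @padic_pX_dvd (padic_of p_pr coh - b n) n; last first.
  by exists y; rewrite -/(b n) -Hy addrC subrK.
have E : (padic_of p_pr coh) n = b n n by rewrite residue_padic_of residueK.
have : (padic_of p_pr coh - b n + b n) n = b n n by rewrite subrK E.
rewrite residue_add -[RHS]residueK -[in RHS](add0n (b n n)) => /eqP.
by rewrite eqn_modDr mod0n residueK => /eqP.
Qed.

Lemma padic_dvdpX x n : (exists y, x ^+ n = p%:R * y) -> exists y, x = p%:R * y.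
Proof.
move=> [y Hy]; have [x1|x1] := eqVneq (x 1) 0%N.
  by have [z ->] := padic_pX_dvd x1; exists z.
have [z xz] := padic_unit x1.
have H : 1 = p%:R * (y * z ^+ n).
  by rewrite mulrA -Hy -exprMn xz expr1n.
have := padic_pXM0 (y * z ^+ n) 1; rewrite expr1 -H -[1]/(1%:R).
by rewrite residue_nat modn_small // expn1 prime_gt1.
Qed.

Lemma padic_p_nunit x : p%:R * x <> 1.
Proof.
move=> H; have := padic_pXM0 x 1; rewrite expr1 H -[1]/(1%:R).
by rewrite residue_nat modn_small // expn1 prime_gt1.
Qed.

End PadicFacts.

(** * Fractions over a domain: integral closedness, extension of morphisms, denominators *)

Section FractionExtension.
Variable R : idomainType.

Lemma frac_numden (x : {fraction R}) :
  exists a b : R, b != 0 /\ x = tofrac a / tofrac b.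
Proof.
elim/quotW: x => -[[a b] /= b0]; exists a, b; split => //.
have tb0 : tofrac b != 0 by rewrite tofrac_eq0.
apply: (mulIf tb0); rewrite divfK //.
apply/eqP; rewrite /GRing.mul /= !piE.
by rewrite /equivf /FracField.equivf /FracField.mulf /= !numden_Ratio ?mulf_neq0 ?oner_neq0 //= !mulr1 mulrC.
Qed.

Lemma frac_valuation_ring (q : R) : q != 0 ->
    (forall a, a != 0 -> exists mu u v, a = q ^+ mu * u /\ u * v = 1) ->
  forall x : {fraction R},
  (exists a, x = tofrac a) \/ (exists a, x^-1 = tofrac a).
Proof.
move=> q0 decomp x; have [a [b [b0 ->]]] := frac_numden x.
have [->|a0] := eqVneq a 0; first by left; exists 0; rewrite tofrac0 mul0r.
have [m [u [u' [-> uu]]]] := decomp a a0.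
have [n [v [v' [-> vv]]]] := decomp b b0.
have qn0 : tofrac q != 0 by rewrite tofrac_eq0.
have un0 (c c' : R) : c * c' = 1 -> tofrac c != 0.
  move=> cc; rewrite tofrac_eq0; apply/eqP => c0.
  by move/esym/eqP: cc; rewrite c0 mul0r oner_eq0.
have uinv (c c' : R) : c * c' = 1 -> (tofrac c)^-1 = tofrac c'.
  move=> cc; apply: (mulfI (un0 _ _ cc)); rewrite mulfV ?(un0 _ _ cc) //.
  by rewrite -tofracM cc tofrac1.
rewrite !tofracM !tofracXn.
have un := un0 _ _ uu; have vn := un0 _ _ vv.
have [le|le] := leqP n m.
  left; exists (u * v' * q ^+ (m - n)).
  by rewrite expf_ratio // !tofracM tofracXn (uinv _ _ vv).
right; exists (v * u' * q ^+ (n - m)).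
by rewrite invf_div (expf_ratio _ qn0 un (ltnW le)) !tofracM tofracXn (uinv _ _ uu).
Qed.

(** When [x^-1 = a] lies in [R], dividing a monic equation of degree [n + 1] by [x ^ n] writes [x]
    as a polynomial in [a]. *)
Lemma frac_integrally_closed :
    (forall x : {fraction R}, (exists a, x = tofrac a) \/ (exists a, x^-1 = tofrac a)) ->
  forall x : {fraction R}, integralOver (@tofrac R) x -> exists a, x = tofrac a.
Proof.
move=> V x.
have [//|[a Ea]] := V x => -[q q_mon qx].
have [->|x0] := eqVneq x 0; first by exists 0; rewrite rmorph0.
have sq : (0 < size q)%N by rewrite size_poly_gt0 monic_neq0.
exists (- \sum_(i < (size q).-1) q`_i * a ^+ ((size q).-2 - i)).
have n0 : ((size q).-1 != 0)%N.
  apply: contraTneq qx => E0; have /eqP sq1 : size q == 1%N by rewrite -(prednK sq) E0.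
  have -> : q = 1.
    rewrite (size1_polyC (eq_leq sq1)); congr (_%:P).
    by have /monicP := q_mon; rewrite lead_coefE sq1.
  by rewrite rmorph1 rootE hornerC oner_neq0.
case En : (size q).-1 n0 => [|n] // _.
have := rootP qx; rewrite horner_coef size_map_poly_id0; last first.
  by rewrite (monicP q_mon) rmorph1 oner_neq0.
rewrite -(prednK sq) En big_ord_recr /= coef_map /=.
have -> : q`_n.+1 = 1 by rewrite -En -lead_coefE (monicP q_mon).
rewrite rmorph1 mul1r => /eqP; rewrite addrC addr_eq0 => /eqP E0.
have xn0 : x ^+ n != 0 by rewrite expf_neq0.
apply: (mulIf xn0); rewrite -exprS E0 rmorphN mulNr; congr (- _).
rewrite rmorph_sum mulr_suml; apply: eq_bigr => i _.
rewrite coef_map /= rmorphM rmorphXn /= -Ea -mulrA; congr (_ * _).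
have le_in : (i <= n)%N by rewrite -ltnS.
by rewrite exprVn -[X in _ * x ^+ X](subnK le_in) exprD mulKf ?expf_neq0.
Qed.

Variables (E : fieldType) (f : {rmorphism R -> E}) (f_inj : injective f).

Lemma frac_ext_exists (x : {fraction R}) :
  exists y : E, forall a b, b != 0 -> x = tofrac a / tofrac b -> y = f a / f b.
Proof.
have fn0 a : a != 0 -> f a != 0 by move=> a0; rewrite -(rmorph0 f) (inj_eq f_inj).
have [a [b [b0 ->]]] := frac_numden x; exists (f a / f b) => a' b' b'0 /eqP.
have tn0 c : c != 0 -> tofrac c != 0 :> {fraction R} by rewrite tofrac_eq0.
rewrite eqr_div ?tn0 // -!rmorphM /= tofrac_eq => /eqP E0.
by apply/eqP; rewrite eqr_div ?fn0 // -!rmorphM E0.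
Qed.

Definition frac_ext x := sval (cid (frac_ext_exists x)).

Lemma frac_extE a b : b != 0 -> frac_ext (tofrac a / tofrac b) = f a / f b.
Proof. by move=> b0; rewrite /frac_ext; case: cid => y /= /(_ a b b0 erefl). Qed.

Lemma frac_ext_tofrac a : frac_ext (tofrac a) = f a.
Proof.
have := frac_extE a (oner_neq0 R).
by rewrite !rmorph1 !divr1.
Qed.

Fact frac_ext_is_zmod_morphism : zmod_morphism frac_ext.
Proof.
move=> x y; have [a [b [b0 ->]]] := frac_numden x.
have [c [d [d0 ->]]] := frac_numden y.
have tn0 e : e != 0 -> tofrac e != 0 :> {fraction R} by rewrite tofrac_eq0.
have fn0 e : e != 0 -> f e != 0 by move=> e0; rewrite -(rmorph0 f) (inj_eq f_inj).
have -> : tofrac a / tofrac b - tofrac c / tofrac d = tofrac (a * d - c * b) / tofrac (b * d).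
  by rewrite subf_div ?tn0 // rmorphB !rmorphM.
by rewrite !frac_extE ?mulf_neq0 // subf_div ?fn0 // rmorphB !rmorphM.
Qed.

Fact frac_ext_is_monoid_morphism : monoid_morphism frac_ext.
Proof.
split=> [|x y]; first by rewrite -(rmorph1 (@tofrac R)) frac_ext_tofrac rmorph1.
have [a [b [b0 ->]]] := frac_numden x; have [c [d [d0 ->]]] := frac_numden y.
have -> : tofrac a / tofrac b * (tofrac c / tofrac d) = tofrac (a * c) / tofrac (b * d).
  by rewrite mulf_div !rmorphM.
by rewrite !frac_extE ?mulf_neq0 // mulf_div -!rmorphM.
Qed.

HB.instance Definition _ := GRing.isZmodMorphism.Build {fraction R} E frac_ext
  frac_ext_is_zmod_morphism.
HB.instance Definition _ := GRing.isMonoidMorphism.Build {fraction R} E frac_ext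
  frac_ext_is_monoid_morphism.

Lemma frac_clear (q : {poly {fraction R}}) : q != 0 ->
  exists (r : {poly R}) (c : R), [/\ c != 0, r != 0 & map_poly (@tofrac R) r = tofrac c *: q].
Proof.
move=> q0.
have [c [c0 Hc]] : exists c : R, c != 0 /\ forall i, exists a, tofrac c * q`_i = tofrac a.
  have [c [c0 Hc]] : exists c : R, c != 0 /\ forall i, (i < size q)%N -> exists a, tofrac c * q`_i = tofrac a.
    elim: (size q) => [|n [c [c0 Hc]]]; first by exists 1; rewrite oner_neq0.
    have [a [b [b0 qn]]] := frac_numden q`_n.
    exists (c * b); split; first by rewrite mulf_neq0.
    move=> i; rewrite ltnS leq_eqVlt => /predU1P[->|/Hc[a' Ha']].
      exists (c * a); rewrite qn !tofracM mulrA [_ * tofrac a]mulrAC mulfK //.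
      by rewrite tofrac_eq0.
    by exists (a' * b); rewrite !tofracM -Ha' mulrAC.
  exists c; split => // i; have [/Hc//|le_i] := ltnP i (size q).
  by exists 0; rewrite nth_default // mulr0 rmorph0.
pose a i := sval (cid (Hc i)).
have Ha i : tofrac c * q`_i = tofrac (a i) by rewrite /a; case: cid.
exists (\poly_(i < size q) a i), c.
have E0 : map_poly (@tofrac R) (\poly_(i < size q) a i) = tofrac c *: q.
  apply/polyP=> i; rewrite coef_map coef_poly coefZ /=.
  case: ltnP => [_|le_i]; first by rewrite Ha.
  by rewrite nth_default // mulr0 rmorph0.
split => //; apply: contraNneq q0 => r0; move: E0; rewrite r0 rmorph0 => /esym/eqP.
by rewrite scaler_eq0 tofrac_eq0 (negPf c0).
Qed.

End FractionExtension.

Section AlgebraicOverDomain.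
Variables (R : idomainType) (E : fieldType) (f : {rmorphism R -> E}) (f_inj : injective f).

Lemma frac_algP (x : E) : algebraicOver (frac_ext f_inj) x <->
  exists2 q : {poly R}, q != 0 & root (map_poly f q) x.
Proof.
have Eq (q : {poly R}) : map_poly f q = map_poly (frac_ext f_inj) (map_poly (@tofrac R) q).
  by rewrite -map_poly_comp /=; apply: eq_map_poly => a /=; rewrite frac_ext_tofrac.
split=> [[q q0 qx]|[q q0 qx]].
  have [r [c [c0 r0 Er]]] := frac_clear q0; exists r => //.
  by rewrite Eq Er map_polyZ rootE hornerZ (rootP qx) mulr0.
exists (map_poly (@tofrac R) q); last by rewrite -Eq.
by rewrite map_poly_eq0_id0 // tofrac_eq0 lead_coef_eq0.
Qed.

Lemma root_const_neq0 (x : E) : x != 0 -> (exists2 q : {poly R}, q != 0 & root (map_poly f q) x) ->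
  exists2 q : {poly R}, q`_0 != 0 & root (map_poly f q) x.
Proof.
move=> x0 [q]; have [n] := ubnP (size q); elim: n q => // n IHn q le_q q0 qx.
have [q00|] := eqVneq q`_0 0; last by exists q.
have [r Er] : exists r, q = r * 'X.
  have /factor_theorem[r] : root q 0 by rewrite rootE horner_coef0 q00.
  by rewrite subr0; exists r.
have r0 : r != 0 by apply: contraNneq q0 => r0; rewrite Er r0 mul0r.
apply: (IHn r) => //; first by rewrite Er size_mulX in le_q.
by move: qx; rewrite Er rmorphM /= map_polyX rootM rootX (negPf x0) orbF.
Qed.

End AlgebraicOverDomain.

Section PadicIntegrallyClosed.
Variables (p : nat) (p_pr : prime p).
Local Notation Zp := (padic_int p_pr).

Lemma padic_valuation_ring (x : padic p_pr) :
  (exists a : Zp, x = tofrac a) \/ (exists a : Zp, x^-1 = tofrac a).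
Proof. exact: (frac_valuation_ring (padic_p_neq0 p_pr) (@padic_unit_decomp _ p_pr)). Qed.

Lemma padic_integrally_closed (x : padic p_pr) :
  integralOver (@tofrac Zp) x -> exists a : Zp, x = tofrac a.
Proof. exact: frac_integrally_closed padic_valuation_ring x. Qed.

End PadicIntegrallyClosed.

(** * Integral elements of the algebraic closure *)

HB.instance Definition _ (R : comNzRingType) (E : fieldType) (f : {rmorphism R -> E}) :=
  GRing.isSubringClosed.Build E (integral_over_pred f) (integral_subring_closed f).

Section LeadCoefIntegral.
Variables (R : comNzRingType) (E : fieldType) (f : {rmorphism R -> E}).

Lemma lead_coef_integral (r : {poly R}) x : (1 < size r)%N -> root (map_poly f r) x ->
  integralOver f (f (lead_coef r) * x).
Proof.
move=> sr rx; set a := lead_coef r; set d := (size r).-1.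
have sd : size r = d.+1 by rewrite prednK // ltnW.
have d_gt0 : (0 < d)%N by rewrite -ltnS -sd.
pose s := \sum_(i < d) (r`_i * a ^+ (d.-1 - i)) *: 'X^i.
have ss : (size s <= d)%N.
  apply: (leq_trans (size_sum _ _ _)); apply/bigmax_leqP => i _.
  by apply: (leq_trans (size_scale_leq _ _)); rewrite size_polyXn.
exists ('X^d + s).
  rewrite monicE lead_coefDl ?lead_coefXn // size_polyXn ltnS //.
rewrite rootE rmorphD /= map_polyXn hornerD hornerXn /s rmorph_sum horner_sum.
have adE : f a ^+ d = f a ^+ d.-1 * f a by rewrite -exprSr prednK.
have /eqP : f a ^+ d.-1 * (map_poly f r).[x] = 0 by rewrite (rootP rx) mulr0.
rewrite (@horner_coef_wide _ d.+1) -?sd ?size_poly // sd.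
rewrite big_ord_recr /= coef_map /= -/a mulrDr addrC.
rewrite -[r`__]/(r`_(size r).-1) -lead_coefE -/a mulrA -adE -exprMn => /eqP E0.
apply/eqP; rewrite -[RHS]E0; congr (_ + _); rewrite mulr_sumr.
apply: eq_bigr => i _; rewrite map_polyZ hornerZ map_polyXn hornerXn coef_map /=.
have le_i : (i <= d.-1)%N by rewrite -ltnS prednK.
rewrite rmorphM rmorphXn exprMn -[in RHS](subnK le_i) exprD.
by ring.
Qed.

End LeadCoefIntegral.

Lemma one_addX_prime (R : comNzRingType) (z : R) q : prime q.+1 ->
  (1 + z) ^+ q.+1 - 1 =
    z ^+ q.+1 + q.+1%:R * (z * \sum_(i < q) ('C(q.+1, i.+1) %/ q.+1)%:R * z ^+ i).
Proof.
move=> q_pr; rewrite exprDn big_ord_recl big_ord_recr /=.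
rewrite bin0 expr1n expr0 mul1r mulr1n /bump /= add1n binn mulr1n subnn expr0 mul1r.
rewrite [1 + _]addrC addrK addrC; congr (_ + _).
rewrite !mulr_sumr; apply: eq_bigr => i _.
rewrite expr1n mul1r /bump /= add1n [z * _]mulrCA -exprS mulrA -natrM mulr_natl.
rewrite [(_ * _)%N]mulnC divnK //.
by apply: prime_dvd_bin => //=; rewrite ltnS.
Qed.

Section PadicClosure.
Variables (p : nat) (p_pr : prime p) (C : closedFieldType).
Variable k0 : {rmorphism padic p_pr -> C}.
Local Notation Zp := (padic_int p_pr).

Definition padic_emb : {rmorphism Zp -> C} := (k0 \o @tofrac Zp : {rmorphism Zp -> C}).
Local Notation k := padic_emb.

Definition zbar : {pred C} := integral_over_pred k.
HB.instance Definition _ := GRing.SubringClosed.on zbar.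

Lemma zbar_emb a : k a \in zbar.
Proof. exact: ic_in_subproof. Qed.

Lemma padic_emb_inj : injective k.
Proof. by move=> a b /fmorph_inj/eqP; rewrite tofrac_eq => /eqP. Qed.

Lemma zbar_padic x : k0 x \in zbar -> exists a : Zp, x = tofrac a.
Proof.
move=> /asboolP[q q_mon qx]; apply: padic_integrally_closed; exists q => //.
by move: qx; rewrite map_poly_comp fmorph_root.
Qed.

Lemma char_closure n : (n%:R == 0 :> C) = (n == 0%N).
Proof.
rewrite -(rmorph_nat k) -(rmorph0 k) (inj_eq padic_emb_inj).
case: n => [|n]; first by rewrite mulr0n !eqxx.
exact: negPf (padic_nat_neq0 p_pr (ltn0Sn n)).
Qed.

Lemma p_closure_neq0 : p%:R != 0 :> C.
Proof. by rewrite char_closure -lt0n prime_gt0. Qed.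

Lemma p_inv_nzbar : (p%:R : C)^-1 \notin zbar.
Proof.
apply/negP; rewrite -(rmorph_nat k) /= -fmorphV => /zbar_padic[a].
move=> /(congr1 ( *%R (tofrac p%:R))); rewrite mulfV ?tofrac_eq0 ?padic_p_neq0 //.
rewrite -tofracM -[LHS]tofrac1 => /eqP; rewrite tofrac_eq => /eqP/esym.
exact: padic_p_nunit.
Qed.

Lemma zbar_unity n x : (0 < n)%N -> x ^+ n = 1 -> x \in zbar.
Proof.
move=> n_gt0 xn; apply/asboolP; exists ('X^n - 1%:P).
  by rewrite monicE lead_coefDl ?lead_coefXn // size_polyN size_polyXn size_polyC oner_neq0 ltnS.
by rewrite rmorphB /= map_polyXn map_polyC /= rmorph1 rootE !hornerE xn subrr.
Qed.

(** For nonzero [a], [b / a \in zbar] stands for [a] divides [b], that is [|b| <= |a|]. *)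
Lemma zbar_div_trans (a b c : C) : b != 0 -> b / a \in zbar -> c / b \in zbar -> c / a \in zbar.
Proof. by move=> b0 ba cb; rewrite -[c](divfK b0) -[_ / a]mulrA rpredM. Qed.

Lemma one_addX_p z : z \in zbar ->
  exists2 t, t \in zbar & (1 + z) ^+ p - 1 = z ^+ p + p%:R * (z * t).
Proof.
move=> zz; exists (\sum_(i < p.-1) ('C(p, i.+1) %/ p)%:R * z ^+ i).
  by rewrite rpred_sum // => i _; rewrite rpredM ?rpred_nat ?rpredX.
have := @one_addX_prime C z p.-1; rewrite prednK ?prime_gt0 //.
exact.
Qed.

Lemma subX_p x : x \in zbar ->
  exists2 t, t \in zbar & x ^+ p - 1 = (x - 1) ^+ p + p%:R * ((x - 1) * t).
Proof.
move=> xz; have [|t tz] := @one_addX_p (x - 1); first by rewrite rpredB ?rpred1.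
by rewrite [1 + _]addrC subrK => E; exists t.
Qed.

Lemma sub1X_pX x n : x \in zbar -> ((x - 1) ^+ (p ^ n) - (x ^+ (p ^ n) - 1)) / p%:R \in zbar.
Proof.
move=> xz; elim: n => [|n IHn]; first by rewrite expn0 !expr1 subrr mul0r rpred0.
have yz : x ^+ (p ^ n) \in zbar by rewrite rpredX.
rewrite expnSr !exprM.
move: (x ^+ (p ^ n)) ((x - 1) ^+ (p ^ n)) yz (rpredX (p ^ n) (rpredB xz (rpred1 zbar))) IHn.
move=> y u yz uz IHn; have [t tz ->] := subX_p yz.
rewrite opprD addrA mulrBl rpredB //; last first.
  by rewrite [p%:R * _]mulrC mulfK ?p_closure_neq0 // rpredM // rpredB ?rpred1.
rewrite subrXX mulrAC rpredM // rpred_sum // => i _.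
by rewrite rpredM ?rpredX ?rpredB ?rpred1.
Qed.

Lemma sub1_inv_nzbar x n : x ^+ (p ^ n) = 1 -> x != 1 -> (x - 1)^-1 \notin zbar.
Proof.
move=> xn x1; apply/negP => iz; have pn_gt0 : (0 < p ^ n)%N by rewrite expn_gt0 prime_gt0.
have := sub1X_pX n (zbar_unity pn_gt0 xn); rewrite xn subrr subr0 => tz.
have /negP[] := p_inv_nzbar.
have -> : p%:R^-1 = (x - 1) ^+ (p ^ n) / p%:R * (x - 1)^-1 ^+ (p ^ n).
  by rewrite exprVn mulrAC mulfV ?mul1r // expf_neq0 // subr_eq0.
by rewrite rpredM ?rpredX.
Qed.

Lemma subX_div_sub1 x j : x \in zbar -> (x ^+ j - 1) / (x - 1) \in zbar.
Proof.
move=> xz; have [->|x1] := eqVneq x 1; first by rewrite subrr invr0 mulr0 rpred0.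
rewrite subrX1 mulrAC mulfV ?mul1r ?subr_eq0 //.
by rewrite rpred_sum // => i _; rewrite rpredX.
Qed.

(** Since [\sum_(i < p) x ^ i = 0], one has [p = - \sum_(i < p) (x ^ i - 1)], each term being a
    multiple of [x - 1]. *)
Lemma p_div_base x : x ^+ p = 1 -> x != 1 -> p%:R / (x - 1) \in zbar.
Proof.
move=> xp x1; have xz := zbar_unity (prime_gt0 p_pr) xp.
have x10 : x - 1 != 0 by rewrite subr_eq0.
have S0 : \sum_(i < p) x ^+ i = 0.
  apply: (mulfI x10); rewrite mulr0 -subrX1 xp subrr //.
have -> : p%:R / (x - 1) = - \sum_(i < p) (x ^+ i - 1) / (x - 1).
  rewrite -mulr_suml sumrB S0 sub0r mulNr opprK sumr_const card_ord //.
by rewrite rpredN rpred_sum // => i _; apply: subX_div_sub1.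
Qed.

Lemma zbar_divX_le a y i j : (i <= j)%N -> y != 0 -> y \in zbar -> a / y ^+ j \in zbar -> a / y ^+ i \in zbar.
Proof.
move=> le y0 yz aj; have -> : a / y ^+ i = a / y ^+ j * y ^+ (j - i).
  rewrite -[X in _ / y ^+ X * _](subnK le) exprD.
  have := expf_neq0 (j - i) y0; have := expf_neq0 i y0.
  by move: (y ^+ i) (y ^+ (j - i)) => u v u0 v0; field; rewrite u0.
by rewrite rpredM ?rpredX.
Qed.

(** The exact exponent is [(p - 1) * p ^ n]; the bound [2 ^ n] is valid for every [p] and follows by
    induction from the fact that [(x - 1) ^ 2] divides [x ^ p - 1]. *)
Lemma p_div_sub1 n x : x ^+ (p ^ n.+1) = 1 -> x ^+ (p ^ n) != 1 ->
  p%:R / (x - 1) ^+ (2 ^ n) \in zbar.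
Proof.
elim: n x => [|n IHn] x xn xn1.
  by rewrite expr1; apply: p_div_base; rewrite // ?expn1 in xn xn1 *.
have x1 : x - 1 != 0 by rewrite subr_eq0; apply: contraNneq xn1 => ->; rewrite expr1n.
have xz : x \in zbar by apply: zbar_unity xn; rewrite expn_gt0 prime_gt0.
have x1z : x - 1 \in zbar by rewrite rpredB ?rpred1.
have Hp : p%:R / (x ^+ p - 1) ^+ (2 ^ n) \in zbar.
  by apply: IHn; rewrite -exprM -expnS.
have xp1 : x ^+ p - 1 != 0.
  by rewrite subr_eq0; apply: contraNneq xn1 => xp; rewrite expnS exprM xp expr1n.
have px : p%:R / (x - 1) \in zbar.
  apply: (zbar_div_trans xp1 (subX_div_sub1 p xz)).
  rewrite -[X in _ / X]expr1; apply: zbar_divX_le Hp; rewrite ?expn_gt0 //.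
  by rewrite rpredB ?rpred1 ?rpredX.
rewrite expnS exprM; apply: zbar_div_trans Hp; first by rewrite expf_neq0.
rewrite -expr_div_n rpredX //; have [t tz ->] := subX_p xz.
rewrite mulrDl rpredD //.
  rewrite -(subnK (prime_gt1 p_pr)) exprD mulfK ?expf_neq0 // rpredX //.
have -> : p%:R * ((x - 1) * t) / (x - 1) ^+ 2 = p%:R / (x - 1) * t by field.
by rewrite rpredM.
Qed.

Lemma order_exists (x : C) n : x ^+ (p ^ n) = 1 -> x != 1 ->
  exists2 m, x ^+ (p ^ m.+1) = 1 & x ^+ (p ^ m) != 1.
Proof.
elim: n => [|n IHn]; first by rewrite expr1 => ->; rewrite eqxx.
by have [/IHn//|] := eqVneq (x ^+ (p ^ n)) 1; exists n.
Qed.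

(** How [|p|] much smaller than [|x - 1|] gets expressed: as the order of [x] grows, higher and
    higher powers of [x - 1] divide [p]. *)
Lemma p_div_large x n l : x ^+ (p ^ n) = 1 -> x ^+ (p ^ l) != 1 ->
  p%:R / (x - 1) ^+ (2 ^ l) \in zbar.
Proof.
move=> xn xl; have x1 : x != 1 by apply: contraNneq xl => ->; rewrite expr1n.
have xz : x \in zbar by apply: zbar_unity xn; rewrite expn_gt0 prime_gt0.
have [m xm xm1] := order_exists xn x1.
apply: zbar_divX_le (p_div_sub1 xm xm1).
- rewrite leq_exp2l // -ltnS ltnNge; apply: contra xl => le.
  by rewrite -(subnKC le) expnD exprM xm expr1n.
- by rewrite subr_eq0.
- by rewrite rpredB ?rpred1.
Qed.

(** For [y] a root of unity of [p]-power order, [(y - 1) ^ 2] divides [y ^ p - 1], so each [p]-th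
    power doubles the exponent. This makes [z ^ d - 1] much smaller than [z - 1] when a high power
    of [p] divides [d]. *)
Lemma subpX_div x n w : x ^+ (p ^ n) = 1 -> (x ^+ (p ^ w) - 1) / (x - 1) ^+ (2 ^ w) \in zbar.
Proof.
move=> xn; have xz : x \in zbar by apply: zbar_unity xn; rewrite expn_gt0 prime_gt0.
elim: w => [|w IHw].
  have [->|x1] := eqVneq x 1; first by rewrite expr1n subrr mul0r rpred0.
  by rewrite !expr1 mulfV ?rpred1 // subr_eq0.
rewrite !expnSr !exprM; set y := x ^+ (p ^ w) in IHw *.
have [y1|y1] := eqVneq y 1; first by rewrite y1 expr1n subrr mul0r rpred0.
have y10 : y - 1 != 0 by rewrite subr_eq0.
have yn : y ^+ (p ^ n) = 1 by rewrite -exprM mulnC exprM xn expr1n.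
have yz : y \in zbar by rewrite rpredX.
have y1z : y - 1 \in zbar by rewrite rpredB ?rpred1.
apply: (@zbar_div_trans _ ((y - 1) ^+ 2)); first by rewrite expf_neq0.
  by rewrite -expr_div_n rpredX.
have [t tz ->] := subX_p yz; rewrite mulrDl rpredD //.
  by rewrite -(subnK (prime_gt1 p_pr)) exprD mulfK ?expf_neq0 // rpredX.
have -> : p%:R * ((y - 1) * t) / (y - 1) ^+ 2 = p%:R / (y - 1) * t by field.
rewrite rpredM //; have := @p_div_large y n 0 yn.
by rewrite expn0 !expr1 => ->.
Qed.

Hypothesis k0_alg : forall x : C, algebraicOver k0 x.

Lemma alg_padic_mul x : exists j, p%:R ^+ j * x \in zbar.
Proof.
have [q q0 qx] := k0_alg x; have [r [c [c0 r0 Er]]] := frac_clear q0.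
have [sr|sr] := leqP (size r) 1.
  have : root (map_poly k r) x.
    by rewrite map_poly_comp Er map_polyZ rootE hornerZ (rootP qx) mulr0.
  rewrite (size1_polyC sr) map_polyC rootC -(rmorph0 k) (inj_eq padic_emb_inj) => /eqP r00.
  by case/eqP: r0; rewrite (size1_polyC sr) r00.
have ri : k (lead_coef r) * x \in zbar.
  apply/asboolP/lead_coef_integral => //.
  by rewrite map_poly_comp Er map_polyZ rootE hornerZ (rootP qx) mulr0.
have /padic_unit_decomp[j [u [v [E uv]]]] : lead_coef r != 0 by rewrite lead_coef_eq0.
exists j; have -> : p%:R ^+ j * x = k v * (k (lead_coef r) * x).
  rewrite mulrA -rmorphM E mulrCA [v * u]mulrC uv mulr1.
  by rewrite rmorphXn rmorph_nat.
by rewrite rpredM ?zbar_emb.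
Qed.

(** Some power of [x - 1] is divisible by [p], so [d] would be divisible by every power of [p],
    whereas some [p ^ j / d] is integral. Thanks to this, an identity between values at a point may
    be checked modulo every power of [z - 1]. *)
Lemma zbar_sub1_separated x n d : x ^+ (p ^ n) = 1 -> x != 1 ->
  (forall M, d / (x - 1) ^+ M \in zbar) -> d = 0.
Proof.
move=> xn x1 dM; apply/eqP; apply: contraT => d0.
have x10 : x - 1 != 0 by rewrite subr_eq0.
have pn_gt0 : (0 < p ^ n)%N by rewrite expn_gt0 prime_gt0.
have [j jz] := alg_padic_mul d^-1.
have := sub1X_pX n (zbar_unity pn_gt0 xn); rewrite xn subrr subr0 => /(rpredX j.+1).
rewrite expr_div_n -exprM => H; have := rpredM jz (rpredM (dM (p ^ n * j.+1)%N) H).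
have p0 := p_closure_neq0.
have -> : p%:R ^+ j * d^-1 * (d / (x - 1) ^+ (p ^ n * j.+1) *
   ((x - 1) ^+ (p ^ n * j.+1) / p%:R ^+ j.+1)) = p%:R^-1.
  have := expf_neq0 (p ^ n * j.+1) x10; have := expf_neq0 j p0; rewrite exprS.
  by move: (_ ^+ j) (_ ^+ (p ^ n * j.+1)) => a b a0 b0; field; rewrite d0 a0 b0 p0.
by rewrite (negPf p_inv_nzbar).
Qed.

End PadicClosure.

Arguments padic_emb : simpl never.

(** * Power series and Weierstrass division *)

Section PowerSeriesFacts.
Variable R : comNzRingType.
Implicit Types (f g : power_series R) (q r : {poly R}).

Definition ps_of_poly q : power_series R := PowerSeries (fun n => q`_n).

Lemma coefps_sub f g n : coefps (f - g) n = coefps f n - coefps g n.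
Proof. by []. Qed.

Fact ps_of_poly_is_zmod_morphism : zmod_morphism ps_of_poly.
Proof. by move=> q r; apply: power_seriesP => n; rewrite coefps_sub /= coefB. Qed.

Fact ps_of_poly_is_monoid_morphism : monoid_morphism ps_of_poly.
Proof.
split=> [|q r]; apply: power_seriesP => n; first by rewrite /= coef1; case: n.
by rewrite coefpsM /= coefM.
Qed.

HB.instance Definition _ := GRing.isZmodMorphism.Build {poly R} (power_series R) ps_of_poly
  ps_of_poly_is_zmod_morphism.
HB.instance Definition _ := GRing.isMonoidMorphism.Build {poly R} (power_series R) ps_of_poly
  ps_of_poly_is_monoid_morphism.

Lemma ps_of_polyC a : ps_of_poly a%:P = ps_const a.
Proof. by apply: power_seriesP => n; rewrite /= coefC; case: n. Qed.

Lemma ps_of_polyX : ps_of_poly 'X = ps_var R.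
Proof. by apply: power_seriesP => n; rewrite /= coefX. Qed.

Lemma coefps_Mn f m n : coefps (f *+ m) n = coefps f n *+ m.
Proof. by elim: m => [|m IHm]; rewrite ?mulr0n ?coefps0 // !mulrS coefpsD IHm. Qed.

Lemma coefps_sum I (s : seq I) (F : I -> power_series R) n :
  coefps (\sum_(i <- s) F i) n = \sum_(i <- s) coefps (F i) n.
Proof.
elim: s => [|a s IHs]; first by rewrite !big_nil coefps0.
by rewrite !big_cons coefpsD IHs.
Qed.

Lemma coefps_natXM f m i n : coefps ((m%:R) ^+ i * f) n = m%:R ^+ i * coefps f n.
Proof. by rewrite -!natrX !mulr_natl coefps_Mn. Qed.

Definition ps_trunc M f : {poly R} := \poly_(i < M) coefps f i.
Definition ps_shift M f : power_series R := PowerSeries (fun n => coefps f (n + M)).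

Lemma coefps_XnM M f n :
  coefps (ps_of_poly 'X^M * f) n = if (n < M)%N then 0 else coefps f (n - M).
Proof.
rewrite coefpsM; case: ltnP => [lt_nM|le_Mn].
  rewrite big1 // => i _; rewrite /= coefXn (ltn_eqF (leq_trans (ltn_ord i) lt_nM)).
  by rewrite mul0r.
rewrite (bigD1 (Ordinal (leq_ltn_trans le_Mn (ltnSn n)))) //= coefXn eqxx mul1r.
rewrite big1 ?addr0 // => i; rewrite -val_eqE /= => ne_i.
by rewrite coefXn (negPf ne_i) mul0r.
Qed.

Lemma ps_truncE M f : f = ps_of_poly (ps_trunc M f) + ps_of_poly 'X^M * ps_shift M f.
Proof.
apply: power_seriesP => n; rewrite coefpsD coefps_XnM /= coef_poly.
by case: ltnP => [_|le]; rewrite ?addr0 // add0r subnK.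
Qed.

Lemma ps_shiftE M f : ps_shift M f = ps_const (coefps f M) + ps_var R * ps_shift M.+1 f.
Proof.
rewrite -ps_of_polyX -['X]expr1; apply: power_seriesP => -[|n]; rewrite coefpsD coefps_XnM /=.
  by rewrite add0n addr0.
by rewrite add0r subn1 addnS.
Qed.

Lemma natX_coef_divided m i f :
  (forall n, exists y, coefps f n = m%:R ^+ i * y) -> exists g, f = m%:R ^+ i * g.
Proof.
move=> H; exists (PowerSeries (fun n => sval (cid (H n)))).
by apply: power_seriesP => n; rewrite coefps_natXM /=; case: cid.
Qed.

Lemma one_addX_primeX (z : R) p n : prime p ->
  exists h, (1 + z) ^+ (p ^ n) - 1 = z ^+ (p ^ n) + p%:R * h.
Proof.
move=> p_pr; elim: n => [|n [h Hh]].
  by exists 0; rewrite !expr1 mulr0 addr0 [1 + z]addrC addrK.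
have := @one_addX_prime R ((1 + z) ^+ (p ^ n) - 1) p.-1.
rewrite prednK ?prime_gt0 // [1 + (_ - 1)]addrC subrK expnSr !exprM => -> //.
rewrite Hh; set u := z ^+ _; set S := \sum_(i < _) _.
exists (h * (\sum_(i < p) (u + p%:R * h) ^+ (p.-1 - i) * u ^+ i) + (u + p%:R * h) * S).
have := subrXX (u + p%:R * h) u p; rewrite [u + _]addrC addrK => E.
rewrite mulrDr mulrA; move/eqP: E; rewrite subr_eq => /eqP->.
by move: (\sum_(i < p) _) => W; ring.
Qed.

End PowerSeriesFacts.

Section MapPowerSeries.
Variables (R S : comNzRingType) (f : {rmorphism R -> S}).

Fact map_ps_is_zmod_morphism : zmod_morphism (map_ps f).
Proof. by move=> g h; apply: power_seriesP => n; rewrite /= rmorphD rmorphN. Qed.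

Fact map_ps_is_monoid_morphism : monoid_morphism (map_ps f).
Proof.
split=> [|g h]; apply: power_seriesP => n.
  by case: n => [|n] /=; rewrite ?rmorph1 ?rmorph0.
by rewrite coefpsM /= rmorph_sum; apply: eq_bigr => i _; rewrite rmorphM.
Qed.

HB.instance Definition _ := GRing.isZmodMorphism.Build (power_series R) (power_series S)
  (map_ps f) map_ps_is_zmod_morphism.
HB.instance Definition _ := GRing.isMonoidMorphism.Build (power_series R) (power_series S)
  (map_ps f) map_ps_is_monoid_morphism.

End MapPowerSeries.

Section PadicDivision.
Variables (p : nat) (p_pr : prime p).
Local Notation Zp := (padic_int p_pr).
Local Notation L0 := (power_series Zp).

Lemma ps_psum (g : nat -> L0) :
  exists s, forall n, exists y, s = \sum_(i < n) p%:R ^+ i * g i + p%:R ^+ n * y.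
Proof.
pose s := PowerSeries (fun j => sval (cid (padic_psum (fun i => coefps (g i) j)))).
exists s => n.
have [j|y Hy] := @natX_coef_divided _ p n (s - \sum_(i < n) p%:R ^+ i * g i).
  have [y Hy] : exists y, coefps s j = \sum_(i < n) p%:R ^+ i * coefps (g i) j + p%:R ^+ n * y.
    by rewrite /s /=; case: cid => a Ha; apply: Ha.
  exists y; rewrite coefps_sub coefps_sum Hy.
  rewrite [X in _ - X](eq_bigr (fun i : 'I_n => p%:R ^+ i * coefps (g i) j)).
    by rewrite addrC addKr.
  by move=> i _; rewrite coefps_natXM.
by exists y; rewrite -Hy addrC subrK.
Qed.

Lemma ps_separated (f : L0) : (forall n, exists y, f = p%:R ^+ n * y) -> f = 0.
Proof.
move=> H; apply: power_seriesP => j; rewrite coefps0; apply: padic_separated => n.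
by have [y ->] := H n; exists (coefps y j); rewrite coefps_natXM.
Qed.

(** Writing [g = lo g + 'X^N * hi g] and replacing ['X^N] by [w - p h] leaves the error
    [- p h (hi g)]. Iterating on the error gives quotient and remainder as [p]-adically convergent
    sums; the latter is a polynomial because all its terms have degree less than [N]. *)
Lemma weierstrass_division (h : {poly Zp}) N (f : L0) :
  exists s (r : {poly Zp}), f = ps_of_poly ('X^N + p%:R * h) * s + ps_of_poly r.
Proof.
pose hi := @ps_shift Zp N; pose lo g := ps_of_poly (@ps_trunc Zp N g).
pose w := ps_of_poly ('X^N + p%:R * h); pose F i := iter i (fun g => - ps_of_poly h * hi g) f.
have step g : g = w * hi g + lo g + p%:R * (- ps_of_poly h * hi g).
  rewrite {1}(ps_truncE N g) -/(lo g) -/(hi g) /w rmorphD rmorphM rmorph_nat /=.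
  by rewrite mulrDl mulrA mulrN mulNr addrAC addrK addrC.
have FE n : f = \sum_(i < n) p%:R ^+ i * (w * hi (F i) + lo (F i)) + p%:R ^+ n * F n.
  elim: n => [|n IHn]; first by rewrite big_ord0 add0r expr0 mul1r.
  by rewrite {1}IHn big_ord_recr /= -addrA exprSr -mulrA -mulrDr -step.
have [s Hs] := ps_psum (fun i => hi (F i)); have [r Hr] := ps_psum (fun i => lo (F i)).
exists s, (ps_trunc N r).
have -> : ps_of_poly (ps_trunc N r) = r.
  apply: power_seriesP => j; rewrite /= coef_poly; case: ltnP => // le_j.
  apply/esym/padic_separated => n; have [y ->] := Hr n; exists (coefps y j).
  rewrite coefpsD coefps_sum big1 ?add0r ?coefps_natXM // => i _.
  by rewrite coefps_natXM /= coef_poly ltnNge le_j mulr0.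
apply/eqP; rewrite -subr_eq0; apply/eqP/ps_separated => n.
have [y Hy] := Hs n; have [y' Hy'] := Hr n.
exists (F n - w * y - y').
rewrite {1}(FE n) {1}Hy {1}Hy' -/w.
rewrite (eq_bigr (fun i : 'I_n => w * (p%:R ^+ i * hi (F i)) + p%:R ^+ i * lo (F i))); last first.
  by move=> i _; rewrite mulrDr mulrCA.
rewrite big_split /= -mulr_sumr.
move: (\sum_(i < n) _) (\sum_(i < n) _) (p%:R ^+ n) (F n) => a b c d.
by rewrite !mulrBr mulrDr [w * (c * y)]mulrCA; ring.
Qed.

End PadicDivision.

(** * Evaluation at roots of unity *)

Section Evaluation.
Variables (p : nat) (p_pr : prime p) (C : closedFieldType).
Variable k0 : {rmorphism padic p_pr -> C}.
Local Notation Zp := (padic_int p_pr).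
Local Notation L0 := (power_series Zp).
Local Notation k := (padic_emb k0).
Local Notation zbar := (zbar k0).

(* [E] is the specialisation [T := z - 1] at a root of unity of order dividing [p ^ n]. *)
Definition is_point (E : {rmorphism L0 -> C}) (z : C) (n : nat) :=
  [/\ z ^+ (p ^ n) = 1, forall a, E (ps_const a) = k a & E (ps_var Zp) = z - 1].

Section Point.
Variables (E : {rmorphism L0 -> C}) (z : C) (n : nat).
Hypothesis Ez : is_point E z n.

Lemma point_unity : z ^+ (p ^ n) = 1. Proof. by case: Ez. Qed.

Lemma point_zbar : z \in zbar.
Proof. by apply: zbar_unity point_unity; rewrite expn_gt0 prime_gt0. Qed.

Lemma point_poly r : E (ps_of_poly r) = (map_poly k r).[z - 1].
Proof.
case: Ez => _ Ec Ev; elim/poly_ind: r => [|r c IHr]; first by rewrite !rmorph0 horner0.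
rewrite !rmorphD !rmorphM /= map_polyX map_polyC hornerMXaddC -IHr.
by rewrite ps_of_polyX ps_of_polyC Ec Ev.
Qed.

Lemma point_division f : exists s (r : {poly Zp}),
  f = ps_of_poly ((1 + 'X) ^+ (p ^ n) - 1) * s + ps_of_poly r.
Proof.
have [h ->] := one_addX_primeX ('X : {poly Zp}) n p_pr.
exact: weierstrass_division.
Qed.

(** [E] is a bare ring morphism, so [f] cannot be evaluated through partial sums. As [E] kills the
    multiples of [(1 + T) ^ (p ^ n) - 1], the remainder of [f] has the same value as [f]. *)
Lemma point_omega s : E (ps_of_poly ((1 + 'X) ^+ (p ^ n) - 1) * s) = 0.
Proof.
rewrite rmorphM point_poly rmorphB rmorphXn rmorphD !rmorph1 /= map_polyX.
rewrite hornerD hornerN hornerC horner_exp hornerD hornerX hornerC.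
by rewrite [1 + _]addrC subrK point_unity subrr mul0r.
Qed.

Lemma point_value f : exists r : {poly Zp}, E f = (map_poly k r).[z - 1].
Proof.
have [s [r ->]] := point_division f; exists r.
by rewrite rmorphD point_omega add0r point_poly.
Qed.

Lemma point_int f : E f \in zbar.
Proof.
have [r ->] := point_value f; rewrite horner_coef rpred_sum // => i _.
by rewrite coef_map rpredM ?rpredX ?zbar_emb // rpredB ?rpred1 ?point_zbar.
Qed.

(** Modulo [(z - 1) ^ (l + 1)] only the term of degree [l] survives, and its coefficient is a unit;
    divisibility would make [z - 1] invertible. *)
Lemma point_unit_coef (f : L0) l : (forall j, (j < l)%N -> coefps f j 1 = 0%N) ->
    coefps f l 1 != 0%N -> z != 1 -> p%:R / (z - 1) ^+ l.+1 \in zbar ->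
  E f / (z - 1) ^+ l.+1 \notin zbar.
Proof.
move=> f_lt fl z1 pz; apply/negP => fz; case: (Ez) => zn Ec Ev.
have [|a Ha] := @natX_coef_divided _ p 1 (ps_of_poly (ps_trunc l f)).
  move=> j; rewrite /= coef_poly; case: ltnP => [lt_j|_]; last by exists 0; rewrite mulr0.
  by apply: padic_pX_dvd; apply: f_lt.
have [v0 vv] := padic_unit fl.
have z0 : z - 1 != 0 by rewrite subr_eq0.
have Ef : E f = p%:R * E a + (z - 1) ^+ l * (k (coefps f l) + (z - 1) * E (ps_shift l.+1 f)).
  rewrite {1}(ps_truncE l f) Ha expr1 rmorphD !rmorphM rmorph_nat rmorphXn /=.
  by rewrite ps_of_polyX rmorphXn Ev ps_shiftE rmorphD rmorphM Ec Ev.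
have /negP[] := sub1_inv_nzbar k0 zn z1.
have -> : (z - 1)^-1 = k v0 * (E f / (z - 1) ^+ l.+1 - p%:R / (z - 1) ^+ l.+1 * E a
      - E (ps_shift l.+1 f)).
  have kv : k (coefps f l) * k v0 = 1 by rewrite -rmorphM vv rmorph1.
  have kv0 : k v0 != 0 by apply: contraTneq isT => H; move/eqP: kv; rewrite H mulr0 eq_sym oner_eq0.
  rewrite Ef exprS; have zl := expf_neq0 l z0; move: (_ ^+ l) zl => y y0.
  apply: (mulIf z0); rewrite mulVf // -[LHS]kv; move: (z - 1) z0 => t t0.
  by field; rewrite t0 y0.
apply: rpredM; first exact: zbar_emb.
by apply: rpredB (point_int _); apply: rpredB => //; apply: rpredM (point_int _).
Qed.

End Point.

Lemma min_unit_coef (f : L0) : (exists j, coefps f j 1 != 0%N) ->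
  exists l, (forall j, (j < l)%N -> coefps f j 1 = 0%N) /\ coefps f l 1 != 0%N.
Proof.
move=> ex; case: (ex_minnP ex) => l fl l_min; exists l; split=> // j lt_j.
by apply/eqP; apply: contraTT lt_j => /l_min; rewrite -leqNgt.
Qed.

(** After removal of a power of [p], let [l] be the degree of the first unit coefficient. Then
    [(z - 1) ^ (l + 1)] does not divide the value as soon as the order of [z] is large enough for
    this power to divide [p]. *)
Lemma point_neq0 (f : L0) : f != 0 ->
  exists l, forall E z n, is_point E z n -> z ^+ (p ^ l) != 1 -> E f != 0.
Proof.
move=> f0; have [|mu [y [Hy [j yj]]]] := @padic_content p p_pr nat (coefps f).
  apply: contrapT => H; case/eqP: f0; apply: power_seriesP => j; rewrite coefps0.
  by apply: contrapT => /eqP fj; apply: H; exists j.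
have Ef : f = p%:R ^+ mu * PowerSeries y.
  by apply: power_seriesP => i; rewrite coefps_natXM Hy.
have [l [l_lt fl]] := @min_unit_coef (PowerSeries y) (ex_intro _ j yj).
exists l.+1 => E z n Ez zl; rewrite Ef rmorphM rmorphXn rmorph_nat mulf_neq0 //.
  by rewrite expf_neq0 // p_closure_neq0.
have z1 : z != 1 by apply: contraNneq zl => ->; rewrite expr1n.
have pz : p%:R / (z - 1) ^+ l.+1 \in zbar.
  apply: zbar_divX_le (p_div_large k0 (point_unity Ez) zl).
  - exact/ltnW/ltn_expl.
  - by rewrite subr_eq0.
  - by rewrite rpredB ?rpred1 ?(point_zbar Ez).
apply/eqP => E0; have /negP[] := point_unit_coef Ez l_lt fl z1 pz.
by rewrite E0 mul0r rpred0.
Qed.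

(** Expand [Q] in powers of [X - 1], remove a power of [p], and let [b m] be the first coefficient
    not divisible by [p], [l] the degree of its first unit coefficient. With [x = z ^ d], the terms
    below [m] are multiples of [p], those above of [(x - 1) ^ (m + 1)]; if [x] were a root, [x - 1],
    hence [(z - 1) ^ (l + 1)], would divide [E (b m)]. *)
Lemma point_root (Q : {poly L0}) : Q != 0 ->
  exists l w, forall E z n d, is_point E z n -> (p ^ w %| d)%N ->
    (z ^+ d) ^+ (p ^ l) != 1 -> (map_poly E Q).[z ^+ d] != 0.
Proof.
move=> Q0; pose Q1 := Q \Po ('X + 1%:P).
have Q10 : Q1 != 0 by rewrite comp_poly_eq0 // size_XaddC.
have [|mu [y [Hy [[i j] yj]]]] := @padic_content p p_pr (nat * nat) (fun ij => coefps Q1`_ij.1 ij.2).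
  apply: contrapT => H; case/eqP: Q10; apply/polyP => i; rewrite coef0.
  apply: power_seriesP => j; rewrite coefps0.
  by apply: contrapT => /eqP fj; apply: H; exists (i, j).
pose b m := PowerSeries (fun j => y (m, j)).
have Eb m : Q1`_m = p%:R ^+ mu * b m.
  by apply: power_seriesP => i'; rewrite coefps_natXM (Hy (m, i')).
have ex_m : exists m, `[< exists j, coefps (b m) j 1 != 0%N >].
  by exists i; apply/asboolP; exists j.
case: (ex_minnP ex_m) => m /asboolP/min_unit_coef[l [l_lt fl]] m_min.
have b_lt m' : (m' < m)%N -> exists g, b m' = p%:R * g.
  move=> lt_m; apply: (@natX_coef_divided _ p 1) => j'; apply: padic_pX_dvd.
  apply: contrapT => /eqP H.
  have /m_min : `[< exists j, coefps (b m') j 1 != 0%N >] by apply/asboolP; exists j'.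
  by rewrite leqNgt lt_m.
(* As [c <= 2 ^ c], the first bound makes both [(x - 1) ^ (m + 1)] and [(z - 1) ^ (l + 1)] divide
   [p], and the second makes [(z - 1) ^ (l + 1)] divide [x - 1]. *)
exists (m + l).+1, l.+1 => E z n d Ez /dvdnP[d' ->] xl; set x := z ^+ _ in xl *.
apply/eqP => Qx.
have z1 : z != 1 by apply: contraNneq xl => z1; rewrite /x z1 !expr1n.
have x1 : x != 1 by apply: contraNneq xl => ->; rewrite expr1n.
have zz := point_zbar Ez; have xz : x \in zbar by rewrite rpredX.
have z0 : z - 1 != 0 by rewrite subr_eq0.
have x0 : x - 1 != 0 by rewrite subr_eq0.
have xn : x ^+ (p ^ n) = 1 by rewrite /x -exprM mulnC exprM (point_unity Ez) expr1n.
have zl : z ^+ (p ^ (m + l).+1) != 1.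
  by apply: contraNneq xl => zl; rewrite /x -exprM mulnC exprM zl expr1n.
have zz1 : z - 1 \in zbar by rewrite rpredB ?rpred1.
have xz1 : x - 1 \in zbar by rewrite rpredB ?rpred1.
have le2 a c : (a <= c)%N -> (a <= 2 ^ c)%N by move=> /leq_trans; apply; exact/ltnW/ltn_expl.
have pz : p%:R / (z - 1) ^+ l.+1 \in zbar.
  by apply: zbar_divX_le (p_div_large k0 (point_unity Ez) zl) => //; rewrite le2 ?ltnS ?leq_addl.
have px : p%:R / (x - 1) ^+ m.+1 \in zbar.
  by apply: zbar_divX_le (p_div_large k0 xn xl) => //; rewrite le2 ?ltnS ?leq_addr.
have /negP[] := point_unit_coef Ez l_lt fl z1 pz.
have xdz : (x - 1) / (z - 1) ^+ l.+1 \in zbar.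
  apply: zbar_divX_le (_ : (x - 1) / (z - 1) ^+ (2 ^ l.+1) \in zbar) => //; first exact/ltnW/ltn_expl.
  have [zw|zw] := eqVneq (z ^+ (p ^ l.+1)) 1.
    by case/eqP: x1; rewrite /x mulnC exprM zw expr1n.
  apply: zbar_div_trans (subpX_div k0 l.+1 (point_unity Ez)) _; first by rewrite subr_eq0.
  by rewrite /x mulnC exprM subX_div_sub1 // rpredX.
apply: (zbar_div_trans x0 xdz).
have Qb : \sum_(i' < size Q1) E (b i') * (x - 1) ^+ i' = 0.
  have p0 : p%:R ^+ mu != 0 :> C by rewrite expf_neq0 // p_closure_neq0.
  apply: (mulfI p0); rewrite mulr0 mulr_sumr -[RHS]Qx.
  have -> : Q = Q1 \Po ('X - 1%:P) by rewrite -comp_polyA comp_polyD comp_polyX comp_polyC subrK comp_polyXr.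
  rewrite map_comp_poly horner_comp rmorphB /= map_polyX map_polyC /= rmorph1 !hornerE.
  rewrite (@horner_coef_wide _ (size Q1)) ?size_poly //; apply: eq_bigr => i' _.
  by rewrite coef_map /= Eb rmorphM rmorphXn rmorph_nat mulrA.
have lt_m : (m < size Q1)%N.
  rewrite ltnNge; apply/negP => le_m; move: (Eb m); rewrite nth_default // => /esym/eqP.
  rewrite mulf_eq0 expf_eq0 => /orP[/andP[_]|/eqP bm].
    move=> /eqP/(congr1 (fun f => coefps f 0)).
    by rewrite coefps_Mn coefps0 => /eqP; rewrite (negPf (padic_p_neq0 p_pr)).
  by move: fl; rewrite bm coefps0 residue0.
move: Qb; rewrite (bigD1 (Ordinal lt_m)) //= => /eqP; rewrite addr_eq0 => /eqP Hm.
have xm0 := expf_neq0 m x0.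
rewrite -(mulfK xm0 (E (b m))) Hm -mulrA -invfM -exprSr mulNr rpredN mulr_suml rpred_sum //.
move=> i'; rewrite -val_eqE /= neq_ltn => /orP[lt_i|gt_i].
  have [g ->] := b_lt _ lt_i.
  rewrite rmorphM rmorph_nat -(mulrA p%:R) mulrAC.
  by apply: rpredM => //; apply: rpredM (point_int Ez g) _; rewrite rpredX.
rewrite -[X in _ ^+ X](subnK gt_i) exprD mulrA mulfK ?expf_neq0 //.
by apply: rpredM (point_int Ez _) _; rewrite rpredX.
Qed.

End Evaluation.

(** * The substitution [T |-> (1 + T) ^ a - 1] and the series [(1 + T) ^ e] *)

Section SubstPow.
Variables (R : comNzRingType) (a : nat).
Implicit Types (f : power_series R) (q : {poly R}).

(* [ps_pow] is the substitution [f |-> f ((1 + T) ^ a - 1)]: only the terms of [f] of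
   degree at most [n] contribute to the coefficient of [T ^ n]. *)
Definition pow_poly : {poly R} := (1 + 'X) ^+ a - 1.
Definition ps_pow f : power_series R :=
  PowerSeries (fun n => (ps_trunc n.+1 f \Po pow_poly)`_n).

Lemma pow_polyE : exists2 g, pow_poly = g * 'X & g`_0 = a%:R.
Proof.
have /factor_theorem[g] : root pow_poly 0.
  by rewrite rootE /pow_poly hornerD hornerN hornerC horner_exp hornerD hornerX hornerC addr0 expr1n subrr.
rewrite subr0 => Eg; exists g => //.
have := coefMX g 1; rewrite -Eg /= => <-.
have -> : pow_poly`_1 = (pow_poly^`())`_0 by rewrite coef_deriv mulr1n.
have d1 : (1 : {poly R})^`() = 0 by rewrite -[1]/(1%:P) derivC.
rewrite /pow_poly derivB deriv_exp derivD derivX d1 add0r subr0 mul1r.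
rewrite -horner_coef0 hornerMn horner_exp hornerD hornerX hornerC.
by rewrite addr0 expr1n.
Qed.

Lemma coef_comp_take q M n : (n < M)%N ->
  (take_poly M q \Po pow_poly)`_n = (q \Po pow_poly)`_n.
Proof.
move=> lt_nM; rewrite -{2}(poly_take_drop M q) comp_polyD coefD.
have [g -> _] := pow_polyE.
by rewrite comp_polyM comp_Xn_poly exprMn mulrA coefMXn lt_nM addr0.
Qed.

Lemma take_ps_trunc M N f : (M <= N)%N -> take_poly M (ps_trunc N f) = ps_trunc M f.
Proof.
move=> le; apply/polyP => i; rewrite !coef_poly; case: ltnP => // lt_i.
by rewrite (leq_trans lt_i le).
Qed.

Lemma coef_ps_pow f M n : (n < M)%N -> coefps (ps_pow f) n = (ps_trunc M f \Po pow_poly)`_n.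
Proof. by move=> lt_n; rewrite /= -(take_ps_trunc f lt_n) coef_comp_take. Qed.

Lemma ps_powD f g : ps_pow (f + g) = ps_pow f + ps_pow g.
Proof.
apply: power_seriesP => n; rewrite coefpsD /= -coefD -comp_polyD; congr (_ \Po _)`_n.
by apply/polyP => i; rewrite coefD !coef_poly; case: ifP; rewrite ?addr0.
Qed.

Lemma ps_pow_poly q : ps_pow (ps_of_poly q) = ps_of_poly (q \Po pow_poly).
Proof.
by apply: power_seriesP => n /=; rewrite -(coef_comp_take q (ltnSn n)).
Qed.

Lemma ps_eq_low (u v : power_series R) M : (forall n, (n < M)%N -> coefps u n = coefps v n) ->
  exists h, u = v + ps_of_poly 'X^M * h.
Proof.
move=> H; exists (ps_shift M (u - v)).
have := ps_truncE M (u - v); rewrite [X in ps_of_poly X](_ : _ = 0) ?rmorph0 ?add0r.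
  by move=> <-; rewrite addrC subrK.
by apply/polyP => i; rewrite coef0 coef_poly; case: ifP => // lt_i; rewrite coefps_sub H ?subrr.
Qed.

(** Multiplicativity, stated modulo each power of [T] so that it reduces to composition of
    polynomials; [zbar_sub1_separated] makes this enough for values at a point. *)
Lemma ps_powM q f M : exists h,
  ps_pow (ps_of_poly q * f) =
    ps_of_poly ((q * ps_trunc M f) \Po pow_poly) + ps_of_poly 'X^M * h.
Proof.
apply: ps_eq_low => n lt_n; rewrite (coef_ps_pow _ lt_n) /=.
rewrite -[in RHS](coef_comp_take _ lt_n); congr (_ \Po _)`_n.
apply/polyP => i; rewrite !coef_poly; case: ltnP => // lt_i.
rewrite coefpsM coefM; apply: eq_bigr => j _; rewrite coef_poly.
by rewrite (leq_ltn_trans (leq_subr j i) lt_i).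
Qed.

End SubstPow.

(** The lowest term [c T ^ n] of [f] becomes [c a ^ n T ^ n] up to higher order. *)
Lemma ps_pow_neq0 (R : idomainType) a (f : power_series R) :
  a%:R != 0 :> R -> f != 0 -> ps_pow a f != 0.
Proof.
move=> a0 f0; have ex_n : exists n, coefps f n != 0.
  apply: contrapT => f_eq0; case/eqP: f0; apply: power_seriesP => n.
  by rewrite coefps0; apply: contrapT => /eqP fn; apply: f_eq0; exists n.
case: (ex_minnP ex_n) => n fn n_min; apply/eqP => /(congr1 (fun g => coefps g n)).
rewrite coefps0 /=; have -> : ps_trunc n.+1 f = coefps f n *: 'X^n.
  apply/polyP => i; rewrite coef_poly coefZ coefXn.
  case: (ltngtP i n) => [lt_in|gt_in|->]; rewrite ?ltnSn ?mulr1 //.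
    rewrite ltnS ltnW // mulr0; apply/eqP; apply: contraTT lt_in => /n_min.
    by rewrite -leqNgt.
  by rewrite ltnS leqNgt gt_in mulr0.
have [g -> g0] := pow_polyE R a.
rewrite comp_polyZ comp_Xn_poly exprMn coefZ coefMXn ltnn subnn -horner_coef0 horner_exp.
by rewrite horner_coef0 g0 => /eqP; rewrite mulf_eq0 expf_eq0 (negPf fn) (negPf a0) andbF.
Qed.

Section BinomialApprox.
Variables (p : nat) (p_pr : prime p).
Local Notation Zp := (padic_int p_pr).

Lemma padic_int_binom_fact (e : Zp) j : j`!%:R * padic_int_binom e j = \prod_(i < j) (e - i%:R).
Proof.
have [b def_b] := padic_fact_dvd e j; rewrite -def_b; congr (_ * _).
apply/eqP; rewrite -tofrac_eq padic_int_binomE.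
have nf0 : j`!%:R != 0 :> padic p_pr.
  by rewrite -(rmorph_nat (@tofrac Zp)) tofrac_eq0 padic_nat_neq0 ?fact_gt0.
apply/eqP; apply: (mulfI nf0); rewrite /padic_binom mulrC divfK //.
rewrite -[X in _ = X * _](rmorph_nat (@tofrac Zp)) -rmorphM def_b rmorph_prod.
by apply: eq_bigr => i _; rewrite rmorphB rmorph_nat.
Qed.

(** [e K] is a natural number congruent to [e] modulo [p ^ K]; dividing the falling factorial by
    [j!] loses only the valuation [v] of [j!]. *)
Lemma padic_binom_approx (e : Zp) j M : exists K0, forall K, (K0 <= K)%N ->
  exists y, padic_int_binom e j - 'C(e K, j)%:R = p%:R ^+ M * y.
Proof.
have [v [u [u' [E uu]]]] := padic_unit_decomp (padic_nat_neq0 p_pr (fact_gt0 j)).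
exists (v + M)%N => K le_K.
have [|y Hy] := @padic_pX_dvd p p_pr (j`!%:R * (padic_int_binom e j - 'C(e K, j)%:R)) K.
  apply/eqP; set x := _ * (_ - _); rewrite -(residueK x).
  have : (x + j`!%:R * 'C(e K, j)%:R) K = (e K ^_ j %% p ^ K)%N.
    by rewrite /x mulrBr subrK padic_int_binom_fact (residue_ffact e j K 0) addn0.
  rewrite residue_add -natrM mulnC bin_ffact residue_nat modnDmr -{2}[(e K ^_ j)%N]add0n.
  by move/eqP; rewrite eqn_modDr mod0n.
exists (u' * p%:R ^+ (K - (v + M)) * y).
have pv0 : p%:R ^+ v != 0 :> Zp by rewrite expf_neq0 // padic_p_neq0.
have u0 : u != 0 by apply/eqP => u0; move/esym/eqP: uu; rewrite u0 mul0r oner_eq0.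
apply: (mulfI (mulf_neq0 pv0 u0)); transitivity (j`!%:R * (padic_int_binom e j - 'C(e K, j)%:R)); first by rewrite E.
rewrite Hy -{1}(subnKC le_K) !exprD.
have gen (A B D U U' Y : Zp) : U * U' = 1 -> A * B * D * Y = A * U * (B * (U' * D * Y)).
  by move=> UU; rewrite -[LHS]mulr1 -UU; ring.
exact: gen uu.
Qed.

Lemma padic_binom_approx_unif (e : Zp) J M : exists K0, forall K j, (K0 <= K)%N -> (j < J)%N ->
  exists y, padic_int_binom e j - 'C(e K, j)%:R = p%:R ^+ M * y.
Proof.
elim: J => [|J [K0 HK]]; first by exists 0%N.
have [K1 HK1] := padic_binom_approx e J M; exists (K0 + K1)%N => K j le_K.
rewrite ltnS leq_eqVlt => /predU1P[->|].
  by apply: HK1; apply: leq_trans le_K; rewrite leq_addl.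
by apply: HK; apply: leq_trans le_K; rewrite leq_addr.
Qed.

End BinomialApprox.

Section PowEvaluation.
Variables (p : nat) (p_pr : prime p) (C : closedFieldType).
Variable k0 : {rmorphism padic p_pr -> C}.
Hypothesis k0_alg : forall x : C, algebraicOver k0 x.
Local Notation Zp := (padic_int p_pr).
Local Notation L0 := (power_series Zp).
Local Notation k := (padic_emb k0).
Local Notation zbar := (zbar k0).
Variables (E : {rmorphism L0 -> C}) (z : C) (n : nat).
Hypotheses (Ez : is_point k0 E z n) (z1 : z != 1).

Lemma point_XnM M h : E (ps_of_poly 'X^M * h) = (z - 1) ^+ M * E h.
Proof.
by case: Ez => _ _ Ev; rewrite rmorphM rmorphXn /= ps_of_polyX rmorphXn Ev.
Qed.

Lemma horner_pow_poly a (r : {poly Zp}) :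
  (map_poly k (r \Po pow_poly Zp a)).[z - 1] = (map_poly k r).[z ^+ a - 1].
Proof.
rewrite map_comp_poly horner_comp /pow_poly rmorphB rmorphXn rmorphD !rmorph1 /= map_polyX.
rewrite hornerD hornerN hornerC horner_exp hornerD hornerX hornerC.
by rewrite [1 + _]addrC subrK.
Qed.

(** Since one polynomial over [Z_p] computes both values, conjugating [z] to [z ^ a] over [Q_p]
    turns [E f] into [E (ps_pow a f)]. It is the remainder of [f], because [(1 + T) ^ (p ^ n) - 1]
    vanishes at [z ^ a - 1] as well. *)
Lemma point_pow a f : exists r : {poly Zp},
  E f = (map_poly k r).[z - 1] /\ E (ps_pow a f) = (map_poly k r).[z ^+ a - 1].
Proof.
have [s [r ->]] := point_division n f; exists r; split.
  by rewrite rmorphD (point_omega Ez) add0r (point_poly Ez).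
rewrite ps_powD rmorphD ps_pow_poly (point_poly Ez) horner_pow_poly.
rewrite [X in X + _](_ : _ = 0) ?add0r //.
apply: (zbar_sub1_separated k0_alg (point_unity Ez) z1) => M.
set q := (_ - 1); have [h ->] := ps_powM a q s M.
rewrite rmorphD (point_poly Ez) horner_pow_poly point_XnM rmorphM hornerM.
have -> : (map_poly k q).[z ^+ a - 1] = 0.
  rewrite /q rmorphB rmorphXn rmorphD !rmorph1 /= map_polyX.
  rewrite hornerD hornerN hornerC horner_exp hornerD hornerX hornerC.
  by rewrite [1 + _]addrC subrK -exprM mulnC exprM (point_unity Ez) expr1n subrr.
rewrite mul0r add0r mulrC mulKf ?(point_int Ez) //.
by rewrite expf_neq0 // subr_eq0.
Qed.

(** For large [K] the series agrees with [(1 + T) ^ (e K)] modulo [p ^ M] and [T ^ M], whose values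
    are both multiples of [(z - 1) ^ M]; [M] is arbitrary. *)
Lemma point_one_plus_T_pow (e : Zp) : E (one_plus_T_pow e) = z ^+ (e n).
Proof.
apply/eqP; rewrite -subr_eq0; apply/eqP.
have z0 : z - 1 != 0 by rewrite subr_eq0.
apply: (zbar_sub1_separated k0_alg (point_unity Ez) z1) => M.
have [K0 HK] := padic_binom_approx_unif e M M.
(* Adding [n] ensures that [e K] and [e n] agree modulo [p ^ n], a period of the powers of [z]. *)
pose K := (K0 + n)%N; have {}HK j := HK K j (leq_addr n K0).
pose q : {poly Zp} := (1 + 'X) ^+ e K.
have qj j : q`_j = 'C(e K, j)%:R.
  rewrite /q addrC exprD1n coef_sum.
  have [le_j|lt_j] := leqP j (e K).
    rewrite (bigD1 (Ordinal (leq_ltn_trans le_j (ltnSn _)))) //= coefMn coefXn eqxx big1 ?addr0 //.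
    by move=> i; rewrite -val_eqE /= eq_sym coefMn coefXn => /negPf->; rewrite mul0rn.
  rewrite bin_small // big1 // => i _; rewrite coefMn coefXn gtn_eqF ?mul0rn //.
  exact: leq_trans (ltn_ord i) _.
pose D := one_plus_T_pow e - ps_of_poly q.
have [|g Hg] := @natX_coef_divided _ p M (ps_of_poly (ps_trunc M D)).
  move=> j; rewrite /= coef_poly; case: ltnP => [lt_j|_]; last by exists 0; rewrite mulr0.
  by rewrite coefps_sub /= qj; apply: HK.
have -> : z ^+ e n = E (ps_of_poly q).
  rewrite (point_poly Ez) /q rmorphXn rmorphD rmorph1 /= map_polyX horner_exp hornerD hornerX hornerC.
  rewrite [1 + _]addrC subrK -(padic_residue_le e (leq_addl K0 n)) -/K.
  by rewrite {2}(divn_eq (e K) (p ^ n)) exprD mulnC exprM (point_unity Ez) expr1n mul1r.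
rewrite -rmorphB -/D (ps_truncE M D) Hg rmorphD point_XnM rmorphM rmorphXn rmorph_nat.
rewrite mulrDl rpredD //; last first.
  by rewrite mulrC mulKf ?(point_int Ez) // expf_neq0.
rewrite mulrAC rpredM ?(point_int Ez) // -expr_div_n rpredX //.
by have := @p_div_large _ _ _ k0 z n 0 (point_unity Ez); rewrite !expr1; apply.
Qed.

End PowEvaluation.

(** * Galois conjugation of roots of unity *)

Lemma tofrac_div_eq (R : idomainType) (x y b : R) :
  y != 0 -> tofrac x / tofrac y = tofrac b -> x = y * b.
Proof.
move=> y0 E; apply/eqP; rewrite -tofrac_eq tofracM -E mulrC divfK //.
by rewrite tofrac_eq0.
Qed.

Lemma tofrac_neq_square (R : idomainType) (x a b : R) : x != 0 -> (forall c, x * c <> 1) ->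
  tofrac (x * a) * tofrac (x * b) <> tofrac x.
Proof.
move=> x0 xc /eqP; rewrite -tofracM tofrac_eq => /eqP E; apply: (xc (a * b)).
by apply: (mulfI x0); rewrite mulr1 -[RHS]E; ring.
Qed.

(** * Elimination by resultants *)

Section CommonRoot.
Variables (A : comNzRingType) (q r : {poly A}).
Hypotheses (q_mon : q \is monic) (r_mon : r \is monic).
Hypotheses (q_gt1 : (1 < size q)%N) (r_gt1 : (1 < size r)%N).

(* The resultant is taken over [{poly A}] and specialised at [0] because
   [map_resultant] only covers morphisms whose source is a polynomial ring. *)
Definition elim_res : A := (resultant (map_poly polyC q) (map_poly polyC r)).[0].

Let eval_const (B : comNzRingType) (phi : {rmorphism A -> B}) :
  exists e : {rmorphism {poly A} -> B}, (forall g, e g = phi g.[0]) /\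
    forall s, map_poly e (map_poly polyC s) = map_poly phi s.
Proof.
exists (phi \o horner_eval 0 : {rmorphism {poly A} -> B}); split=> // s.
rewrite -map_poly_comp; apply: eq_map_poly => a /=.
by rewrite /horner_eval hornerC.
Qed.

Lemma elim_res_root (B : comNzRingType) (phi : {rmorphism A -> B}) y :
  root (map_poly phi q) y -> root (map_poly phi r) y -> phi elim_res = 0.
Proof.
move=> /rootP qy /rootP ry; have [e [He map_e]] := eval_const phi.
have [||[u v] _ /=] := @resultant_in_ideal _ (map_poly polyC q) (map_poly polyC r).
- by rewrite size_map_polyC.
- by rewrite size_map_polyC.
move=> /(congr1 (map_poly e)); rewrite rmorphD !rmorphM /= map_polyC !map_e.
move=> /(congr1 (horner^~ y)); rewrite hornerD !hornerM qy ry !mulr0 addr0 hornerC.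
by rewrite -He.
Qed.

Lemma elim_res_common (B : closedFieldType) (phi : {rmorphism A -> B}) :
  phi elim_res = 0 -> exists y, root (map_poly phi q) y /\ root (map_poly phi r) y.
Proof.
have [e [He map_e]] := eval_const phi.
have lc (s : {poly A}) : s \is monic -> e (lead_coef (map_poly polyC s)) != 0.
  move=> s_mon; rewrite lead_coef_map_inj ?polyC0 //; last exact: polyC_inj.
  by rewrite (monicP s_mon) He hornerC rmorph1 oner_neq0.
rewrite -He map_resultant ?lc // !map_e => /eqP.
rewrite resultant_eq0 => sz; have /closed_rootP[y] : size (gcdp (map_poly phi q) (map_poly phi r)) != 1%N.
  by rewrite gtn_eqF.
by rewrite root_gcd => /andP[qy ry]; exists y.
Qed.

End CommonRoot.

Lemma monic_size1 (R : nzRingType) (q : {poly R}) : q \is monic -> (size q <= 1)%N -> q = 1.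
Proof.
move=> q_mon /size1_polyC E; have := monicP q_mon; rewrite E lead_coefC => q1.
by rewrite q1.
Qed.

(** * Minimal polynomials and conjugates *)

Section MinimalPolynomial.
Variables (F : fieldType) (C : closedFieldType) (f : {rmorphism F -> C}).

Lemma minpoly_exists x : algebraicOver f x ->
  exists g : {poly F}, [/\ g \is monic, root (map_poly f g) x &
    forall r, root (map_poly f r) x -> g %| r].
Proof.
move=> [q0 q00 q0x].
have ex_n : exists n, `[< exists q : {poly F}, [/\ q != 0, root (map_poly f q) x & size q = n] >].
  by exists (size q0); apply/asboolP; exists q0.
case: (ex_minnP ex_n) => n /asboolP[q [q_n0 qx sq]] n_min.
pose g := (lead_coef q)^-1 *: q.
have lq : lead_coef q != 0 by rewrite lead_coef_eq0.
have gx : root (map_poly f g) x by rewrite map_polyZ rootE hornerZ (rootP qx) mulr0.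
have g0 : g != 0 by rewrite scaler_eq0 invr_eq0 (negPf lq).
have sg : size g = n by rewrite size_scale ?invr_eq0.
exists g; split=> // [|r rx]; first by rewrite monicE lead_coefZ mulVf.
rewrite /dvdp; apply/negPn/negP => rg0.
have rgx : root (map_poly f (r %% g)) x.
  have := congr1 (map_poly f) (divp_eq r g); rewrite rmorphD rmorphM /=.
  move=> /(congr1 (horner^~ x)); rewrite hornerD hornerM (rootP gx) (rootP rx) mulr0 add0r.
  by rewrite rootE => <-.
have /n_min : `[< exists q : {poly F}, [/\ q != 0, root (map_poly f q) x & size q = size (r %% g)] >].
  by apply/asboolP; exists (r %% g).
by rewrite leqNgt -sg ltn_modp g0.
Qed.

(* Eisenstein's argument, with the ideal [I] in the role of the multiples of [p]. *)
Lemma eisenstein_value (I : F -> Prop) (Phi : {poly F}) : Phi \is monic ->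
    (forall h, h \is monic -> (1 < size h)%N -> h %| Phi -> I h.[1]) ->
    (forall x y, I x -> I y -> x * y <> Phi.[1]) ->
  forall r z, root (map_poly f Phi) z -> root (map_poly f r) z -> Phi %| r.
Proof.
move=> Phi_mon IH Iprod r z Pz rz.
pose h0 := gcdp r Phi; pose h := (lead_coef h0)^-1 *: h0.
have h00 : h0 != 0 by rewrite gcdp_eq0 (negPf (monic_neq0 Phi_mon)) andbF.
have lh : lead_coef h0 != 0 by rewrite lead_coef_eq0.
have h_mon : h \is monic by rewrite monicE lead_coefZ mulVf.
have hz : root (map_poly f h) z.
  by rewrite map_polyZ rootZ ?fmorph_eq0 ?invr_eq0 // gcdp_map root_gcd rz.
have hP : h %| Phi by rewrite dvdpZl ?invr_eq0 // dvdp_gcdr.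
have hr : h %| r by rewrite dvdpZl ?invr_eq0 // dvdp_gcdl.
have sh : (1 < size h)%N.
  rewrite ltnNge; apply/negP => /(monic_size1 h_mon) h1.
  by move: hz; rewrite h1 rmorph1 rootC oner_eq0.
have /dvdpP[q Eq] := hP.
have q_mon : q \is monic by move: Phi_mon; rewrite Eq monicMr.
have [sq|sq] := ltnP 1 (size q).
  case: (Iprod q.[1] h.[1]); last by rewrite Eq hornerM.
    by apply: IH => //; rewrite Eq dvdp_mulr.
  exact: IH.
by rewrite Eq (monic_size1 q_mon sq) mul1r.
Qed.

Lemma prod_roots_value1 (h : {poly F}) : h \is monic -> exists rs : seq C,
  [/\ all (root (map_poly f h)) rs, size rs = (size h).-1 & f h.[1] = \prod_(r <- rs) (1 - r)].
Proof.
move=> h_mon; have [rs Ers] := closed_field_poly_normal (map_poly f h).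
have lc1 : lead_coef (map_poly f h) = 1 by rewrite lead_coef_map (monicP h_mon) rmorph1.
rewrite lc1 scale1r in Ers; exists rs; split.
- by apply/allP => r rin; rewrite Ers root_prod_XsubC.
- by rewrite -(size_map_poly f) Ers size_prod_XsubC.
- rewrite -{1}(rmorph1 f) -horner_map Ers rmorph1 horner_prod.
  by apply: eq_bigr => r _; rewrite hornerXsubC.
Qed.

Lemma prim_root_exists N : (0 < N)%N -> N%:R != 0 :> C -> exists theta : C, N.-primitive_root theta.
Proof.
move=> N_gt0 N0; have [rs Ers] := closed_field_poly_normal ('X^N - 1 : {poly C}).
have lc1 : lead_coef ('X^N - 1 : {poly C}) = 1 by rewrite lead_coefXnsubC.
rewrite lc1 scale1r in Ers.
have : has N.-primitive_root rs.
  apply: has_prim_root => //.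
  - by apply/allP => r rin; rewrite /root_of_unity /= Ers root_prod_XsubC.
  - by rewrite -separable_prod_XsubC -Ers separable_Xn_sub_1.
  - by rewrite -ltnS -(size_prod_XsubC rs id) -Ers size_XnsubC.
by case/hasP => t _ prim_t; exists t.
Qed.

(** Extends a conjugation from [x ^ u] to [x]: the resultant in [Y] of the minimal polynomial of [x]
    and of [Y ^ u - c] is a polynomial in [c] over [F] that vanishes at [x ^ u], hence at [w]. *)
Lemma conj_lift x u w : algebraicOver f x -> (0 < u)%N ->
    (forall r, root (map_poly f r) (x ^+ u) -> root (map_poly f r) w) ->
  exists2 y, forall r, root (map_poly f r) x -> root (map_poly f r) y & y ^+ u = w.
Proof.
move=> x_alg u_gt0 xw; have [g [g_mon gx g_min]] := minpoly_exists x_alg.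
have [ev Hev] : exists ev : C -> {rmorphism {poly F} -> C}, forall c r, ev c r = (map_poly f r).[c].
  by exists (fun c => (horner_eval c \o map_poly f : {rmorphism {poly F} -> C})).
pose q1 : {poly {poly F}} := map_poly polyC g.
pose q2 : {poly {poly F}} := 'X^u - 'X%:P.
have q1E c : map_poly (ev c) q1 = map_poly f g.
  rewrite -map_poly_comp; apply: eq_map_poly => a /=.
  by rewrite Hev map_polyC hornerC.
have q2E c : map_poly (ev c) q2 = 'X^u - c%:P.
  by rewrite rmorphB /= map_polyXn map_polyC /= Hev map_polyX hornerX.
have q1_mon : q1 \is monic by rewrite monicE lead_coef_map_inj ?(monicP g_mon) //; apply: polyC_inj.
have q2_mon : q2 \is monic by rewrite monicXnsubC.
have q1_gt1 : (1 < size q1)%N.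
  rewrite size_map_polyC -(size_map_poly f).
  by apply: root_size_gt1 gx; rewrite map_poly_eq0 monic_neq0.
have q2_gt1 : (1 < size q2)%N by rewrite size_XnsubC.
have res0 : root (map_poly f (elim_res q1 q2)) (x ^+ u).
  rewrite rootE -Hev; apply/eqP; apply: (elim_res_root q1_gt1 q2_gt1 (y := x)).
    by rewrite q1E.
  by rewrite q2E rootE hornerD hornerN hornerC hornerXn subrr.
have /eqP : (map_poly f (elim_res q1 q2)).[w] = 0 by apply/rootP/xw.
rewrite -Hev => /eqP/(elim_res_common q1_mon q2_mon)[y []].
rewrite q1E q2E => gy; rewrite rootE hornerD hornerN hornerC hornerXn subr_eq0 => /eqP yu.
exists y => // r /g_min/dvdpP[c ->].
by rewrite rmorphM rootM gy orbT.
Qed.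

End MinimalPolynomial.

Section PadicHensel.
Variables (p : nat) (p_pr : prime p).
Local Notation Zp := (padic_int p_pr).

Lemma exprD_taylor (R : comNzRingType) (a h : R) t :
  exists w, (a + h) ^+ t = a ^+ t + t%:R * a ^+ t.-1 * h + h ^+ 2 * w.
Proof.
case: t => [|t]; first by exists 0; rewrite !expr0 mul0r mul0r mulr0 !addr0.
elim: t => [|t [w Hw]]; first by exists 0; rewrite !expr1 expr0 !mul1r mulr0 addr0.
exists (w * (a + h) + t.+1%:R * a ^+ t).
rewrite exprSr Hw /= -[t.+2%:R]/(1 *+ t.+2) [1 *+ t.+2]mulrS !exprSr.
by move: (t.+1%:R) (a ^+ t) => T A; ring.
Qed.

Lemma residue_exp (x : Zp) t n : (x ^+ t) n = (x n ^ t %% p ^ n)%N.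
Proof.
elim: t => [|t IHt]; first by rewrite expr0 expn0 -(residue_nat p_pr 1).
by rewrite exprS residue_mul IHt modnMmr expnS.
Qed.

(** Newton's iteration from [1]: with [v] the valuation of [t] and [k = 2 v + 1], all of
    [1 + p ^ k Z_p] consists of [t]-th powers of units. *)
Lemma hensel_power t : (0 < t)%N -> exists k, forall m n,
  exists2 a, coprime a p & (a ^ t = 1 + p ^ k * m %[mod p ^ n])%N.
Proof.
move=> t_gt0; have [v [u [u' [Et uu]]]] := padic_unit_decomp (padic_nat_neq0 p_pr t_gt0).
exists (v.*2.+1) => m n; set b := (1 + _)%N.
suff [a a1 [y Hy]] : exists2 a : Zp, a 1 != 0%N & exists y, a ^+ t - b%:R = p%:R ^+ (n + v.*2.+1) * y.
  pose l := (n + v.*2.+1)%N; exists (a l).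
    rewrite coprime_sym prime_coprime // /dvdn -{2}[p]expn1 padic_residue_le //.
    by rewrite /l addnS.
  have : (a ^+ t) l = (b%:R : Zp) l.
    have := residue_add (a ^+ t - b%:R) b%:R l; rewrite subrK => ->.
    by rewrite Hy padic_pXM0 add0n residueK.
  rewrite residue_exp residue_nat => /(congr1 (fun x => x %% p ^ n)%N).
  by rewrite !modn_dvdm // dvdn_exp2l // leq_addr.
elim: n => [|n [a a1 [y Hy]]].
  exists 1; first by rewrite -[1]/(1%:R) residue_nat expn1 modn_small ?prime_gt1.
  exists (- m%:R); rewrite expr1n add0n /b natrD natrM natrX.
  by rewrite opprD addrA subrr add0r mulrN.
have [c ac] := padic_unit a1; set l := (n + _)%N in Hy *.
have [i Ei] : exists i, l = (i + v)%N /\ (v < i)%N.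
  by exists (n + v.+1)%N; rewrite /l -addnn; split; lia.
case: Ei => El lt_i.
(* Newton's correction, with [i = l - v]: the linear term [t a ^ (t - 1) p ^ i x] cancels [p ^ l y],
   and [i > v] makes the quadratic one a multiple of [p ^ (l + 1)]. *)
pose x := - y * u' * c ^+ t.-1.
have [w Hw] := exprD_taylor a (p%:R ^+ i * x) t.
exists (a + p%:R ^+ i * x).
  rewrite residue_add -(subnK (leq_ltn_trans (leq0n v) lt_i)) addn1 exprS -mulrA.
  have -> : (p%:R * (p%:R ^+ (i - 1) * x) : Zp) 1 = 0%N.
    by rewrite -{1}[p%:R]expr1 padic_pXM0.
  by rewrite addn0 residueK.
exists (p%:R ^+ (i - v.+1) * x ^+ 2 * w).
have El1 : (n.+1 + v.*2.+1 = i + v.+1)%N by rewrite addSn -/l El addnS.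
rewrite El1 Hw addrAC [_ + _ * _ - _]addrAC Hy Et El.
have ac1 : a ^+ t.-1 * c ^+ t.-1 = 1 by rewrite -exprMn ac expr1n.
have Ei2 : (p%:R ^+ i * x) ^+ 2 * w = p%:R ^+ (i + v.+1) * (p%:R ^+ (i - v.+1) * x ^+ 2 * w).
  by rewrite exprMn -exprM muln2 -addnn -{2}(subnKC lt_i) !exprD; ring.
rewrite Ei2 -[RHS]add0r; congr (_ + _); rewrite /x exprD.
have gen (P V Y U U' A' C' : Zp) : U * U' = 1 -> A' * C' = 1 ->
    P * V * Y + V * U * A' * (P * (- Y * U' * C')) = 0.
  move=> UU AC; have -> : V * U * A' * (P * (- Y * U' * C')) = - (P * V * Y) * ((U * U') * (A' * C')) by ring.
  by rewrite UU AC !mulr1 subrr.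
exact: gen.
Qed.

End PadicHensel.

Section Conjugation.
Variables (p : nat) (p_pr : prime p) (C : closedFieldType).
Variable k0 : {rmorphism padic p_pr -> C}.
Local Notation Zp := (padic_int p_pr).
Local Notation k := (padic_emb k0).
Local Notation zbar := (zbar k0).

(** The cyclotomic polynomial of order [p ^ (n + 1)]; its value [p] at [1] drives the Eisenstein
    argument. *)
Definition cyclo_pp (R : nzRingType) n : {poly R} := \sum_(i < p) 'X^(p ^ n) ^+ i.

Lemma cyclo_ppM (R : comNzRingType) n : ('X^(p ^ n) - 1) * cyclo_pp R n = 'X^(p ^ n.+1) - 1.
Proof. by rewrite -subrX1 -exprM -expnSr. Qed.

Lemma cyclo_pp_monic (R : comNzRingType) n : cyclo_pp R n \is monic.
Proof.
have mon m : ('X^(p ^ m) - 1 : {poly R}) \is monic.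
  by rewrite -polyC1 monicXnsubC // expn_gt0 prime_gt0.
by have := mon n.+1; rewrite -cyclo_ppM monicMl.
Qed.

Lemma cyclo_pp1 (R : comNzRingType) n : (cyclo_pp R n).[1] = p%:R.
Proof.
rewrite /cyclo_pp horner_sum (eq_bigr (fun=> 1)) ?sumr_const ?card_ord // => i _.
by rewrite -exprM hornerXn expr1n.
Qed.

Lemma map_cyclo_pp (R S : nzRingType) (g : {rmorphism R -> S}) n :
  map_poly g (cyclo_pp R n) = cyclo_pp S n.
Proof. by rewrite rmorph_sum; apply: eq_bigr => i _; rewrite -!exprM /= map_polyXn. Qed.

Lemma root_cyclo_pp n z : root (cyclo_pp C n) z -> z ^+ (p ^ n.+1) = 1.
Proof.
move=> /rootP Pz; have := congr1 (horner^~ z) (cyclo_ppM C n).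
rewrite hornerM Pz mulr0 hornerD hornerN hornerC hornerXn => /esym/eqP.
by rewrite subr_eq0 => /eqP.
Qed.

Lemma cyclo_pp_root n z : z ^+ (p ^ n.+1) = 1 -> z ^+ (p ^ n) != 1 -> root (cyclo_pp C n) z.
Proof.
move=> zn zn1; have := congr1 (horner^~ z) (cyclo_ppM C n).
rewrite hornerM !hornerD !hornerN !hornerC !hornerXn zn subrr => /eqP.
by rewrite mulf_eq0 subr_eq0 (negPf zn1).
Qed.

(** [h.[1]] is a nonempty product of factors [1 - r] with [r ^ (p ^ (n + 1)) = 1]. Hence it is
    integral, so in [Z_p], and its [p ^ (n + 1)]-th power is divisible by [p], which forces [p] to
    divide it. *)
Lemma cyclo_pp_value n (h : {poly (padic p_pr)}) : h \is monic -> (1 < size h)%N ->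
  h %| cyclo_pp _ n -> exists a : Zp, h.[1] = tofrac (p%:R * a).
Proof.
move=> h_mon sh hP; have [rs [rs_root srs Ers]] := prod_roots_value1 k0 h_mon.
have rsn r : r \in rs -> r ^+ (p ^ n.+1) = 1.
  move=> /(allP rs_root) hr; apply: root_cyclo_pp; rewrite -(map_cyclo_pp k0 n).
  by have /dvdpP[q ->] := hP; rewrite rmorphM rootM hr orbT.
have pn : (0 < p ^ n.+1)%N by rewrite expn_gt0 prime_gt0.
have rsz r : r \in rs -> 1 - r \in zbar.
  by move=> /rsn/(zbar_unity k0 pn) rz; rewrite rpredB ?rpred1.
have hz : k0 h.[1] \in zbar.
  by rewrite Ers big_seq rpred_prod.
have [a Ea] := zbar_padic hz; rewrite Ea.
case: rs srs Ers rsn rsz {rs_root} => [|r rs] srs Ers rsn rsz.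
  by move: sh; rewrite -ltn_predRL -srs.
have rn := rsn r (mem_head r rs); have rz := zbar_unity k0 pn rn.
have az : k a ^+ (p ^ n.+1) / p%:R \in zbar.
  rewrite [k a](_ : _ = k0 h.[1]); last by rewrite Ea.
  rewrite Ers big_cons exprMn mulrAC; apply: rpredM.
    rewrite -opprB exprNn -mulrA; apply: rpredM; first by rewrite rpredX ?rpredN1.
    by have := sub1X_pX n.+1 rz; rewrite rn subrr subr0.
  rewrite rpredX // big_seq rpred_prod // => s sin.
  by apply: rsz; rewrite inE sin orbT.
have [b Eb] : exists b : Zp, a ^+ (p ^ n.+1) = p%:R * b.
  have p0 := padic_p_neq0 p_pr.
  have [|b Eb] := @zbar_padic _ _ _ k0 (tofrac (a ^+ (p ^ n.+1)) / tofrac p%:R).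
    rewrite fmorph_div -[k0 (tofrac p%:R)]/(k p%:R) rmorph_nat.
    by rewrite -[k0 _]/(k _) rmorphXn.
  by exists b; apply: tofrac_div_eq Eb.
have [c ->] := padic_dvdpX (ex_intro _ b Eb); by exists c.
Qed.

Lemma cyclo_pp_dvd n z (r : {poly (padic p_pr)}) : z ^+ (p ^ n.+1) = 1 -> z ^+ (p ^ n) != 1 ->
  root (map_poly k0 r) z -> cyclo_pp _ n %| r.
Proof.
move=> zn zn1; pose I x := exists a : Zp, x = tofrac (p%:R * a).
apply: (@eisenstein_value _ _ k0 I); rewrite ?map_cyclo_pp.
- exact: cyclo_pp_monic.
- exact: cyclo_pp_value.
- move=> _ _ [a ->] [b ->]; rewrite cyclo_pp1 -(rmorph_nat (@tofrac Zp)).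
  exact: tofrac_neq_square (padic_p_neq0 p_pr) (@padic_p_nunit p p_pr).
- exact: cyclo_pp_root.
Qed.

Lemma cyclo_pp_conj n z a (r : {poly (padic p_pr)}) : z ^+ (p ^ n.+1) = 1 -> z ^+ (p ^ n) != 1 ->
  coprime a p -> root (map_poly k0 r) z -> root (map_poly k0 r) (z ^+ a).
Proof.
move=> zn zn1 co_a rz; have /dvdpP[q ->] := cyclo_pp_dvd zn zn1 rz.
rewrite rmorphM rootM /= map_cyclo_pp cyclo_pp_root ?orbT //.
  by rewrite exprAC zn expr1n.
have co : coprime a (p ^ n.+1) by rewrite coprime_pexpr.
apply: contra zn1 => /eqP za.
have := Euler_exp_totient co; set t := totient _ => Ht.
have t_gt0 : (0 < t)%N by rewrite totient_gt0 expn_gt0 prime_gt0.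
have zt : z ^+ (a ^ t) = z by rewrite -(expr_mod _ zn) Ht (expr_mod _ zn) expr1.
by rewrite -zt -(prednK t_gt0) expnS exprM exprAC za expr1n.
Qed.

Hypothesis k0_alg : forall x : C, algebraicOver k0 x.

(** Galois conjugacy over [Q_p], stated through polynomials so that no automorphism has to be
    constructed. *)
Definition conj_over (x y : C) :=
  forall r : {poly (padic p_pr)}, root (map_poly k0 r) x -> root (map_poly k0 r) y.

Lemma conj_overX x s t : conj_over x (x ^+ s) -> conj_over x (x ^+ (s ^ t)).
Proof.
move=> xs; elim: t => [|t IHt]; first by rewrite expn0 expr1.
move=> r rx; have := IHt (r \Po 'X^s).
rewrite !map_comp_poly !map_polyXn !root_comp !hornerXn -exprM -expnSr; apply.
exact: xs.
Qed.

(** Otherwise [th ^ s] is a root of ['X^j - 1] with [j < N]. This polynomial then shares a factor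
    with the minimal polynomial of [th], hence kills [th], against its order. *)
Lemma conj_prim_coprime N th s : N.-primitive_root th -> conj_over th (th ^+ s) -> coprime s N.
Proof.
move=> th_prim ths; have N_gt0 := prim_order_gt0 th_prim.
have [g [g_mon gth g_min]] := minpoly_exists (k0_alg th).
have gs : root (map_poly k0 g) (th ^+ s) := ths g gth.
pose j := (N %/ gcdn s N)%N; pose h : {poly (padic p_pr)} := 'X^j - 1.
have hx x : root (map_poly k0 h) x = (x ^+ j == 1).
  by rewrite /h rmorphB /= map_polyXn rmorph1 rootE hornerD hornerN hornerC hornerXn subr_eq0.
have hs : root (map_poly k0 h) (th ^+ s).
  rewrite hx -exprM muln_divA ?dvdn_gcdr // mulnC -muln_divA ?dvdn_gcdl //.
  by rewrite exprM (prim_expr_order th_prim) expr1n.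
have [q Eq] : exists q, g = q * gcdp g h by apply/dvdpP; rewrite dvdp_gcdl.
have g0 : g != 0 := monic_neq0 g_mon.
have d0 : gcdp g h != 0 by rewrite gcdp_eq0 (negPf g0).
have sd : (1 < size (gcdp g h))%N.
  rewrite -(size_map_poly k0) gcdp_map; apply: (@root_size_gt1 _ (th ^+ s)).
    by rewrite -gcdp_map map_poly_eq0.
  by rewrite root_gcd gs hs.
have : root (map_poly k0 (gcdp g h)) th.
  move: gth; rewrite {1}Eq rmorphM rootM => /orP[/g_min gq|//].
  have q0 : q != 0 by apply: contraNneq g0 => q0; rewrite Eq q0 mul0r.
  have := dvdp_leq q0 gq; rewrite {1}Eq size_mul // => le.
  have sq : (0 < size q)%N by rewrite size_poly_gt0.
  by exfalso; clear -le sq sd; lia.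
rewrite gcdp_map root_gcd => /andP[_]; rewrite hx -(prim_order_dvd th_prim).
have Ej : (j * gcdn s N = N)%N := divnK (dvdn_gcdr s N).
have j_gt0 : (0 < j)%N by rewrite divn_gt0 ?gcdn_gt0 ?N_gt0 ?orbT // dvdn_leq ?dvdn_gcdr.
move=> /(dvdn_leq j_gt0) le_Nj; rewrite /coprime; apply/eqP.
by move: (gcdn s N) Ej => e Ej; clear -N_gt0 j_gt0 le_Nj Ej; nia.
Qed.

(** The automorphism is represented by its effect on a root of unity [th] having [z] and [xi] among
    its powers. Choose [a] with [a ^ totient m0 = 1 + p ^ d m] modulo [p ^ (n + 1)], lift
    [z |-> z ^ a] to some [th |-> th ^ s], and iterate [totient m0] times: [xi] is then fixed by
    Euler's theorem. Uniformity matters: [d] is chosen before [n] and [z]. *)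
Lemma unity_conj_AP xi m0 : m0.-primitive_root xi ->
  exists d, forall n z, z ^+ (p ^ n.+1) = 1 -> z ^+ (p ^ n) != 1 ->
    exists th u v, [/\ th ^+ u = z, th ^+ v = xi & forall m, exists w,
      [/\ conj_over th w, w ^+ u = z ^+ (1 + p ^ d * m) & w ^+ v = xi]].
Proof.
move=> xi_prim; have m0_gt0 := prim_order_gt0 xi_prim.
have t_gt0 : (0 < totient m0)%N by rewrite totient_gt0.
have [d Hd] := hensel_power p_pr t_gt0; exists d => n z zn zn1.
pose N := (p ^ n.+1 * m0)%N; have N_gt0 : (0 < N)%N by rewrite muln_gt0 expn_gt0 prime_gt0.
have [|th th_prim] := @prim_root_exists C N N_gt0; first by rewrite (char_closure k0) -lt0n.
have [|[u _] /= Ez] := prim_rootP th_prim (_ : z ^+ N = 1); first by rewrite exprM zn expr1n.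
have [|[v _] /= Exi] := prim_rootP th_prim (_ : xi ^+ N = 1).
  by rewrite /N mulnC exprM (prim_expr_order xi_prim) expr1n.
exists th, u, v; split=> // m.
have u_gt0 : (0 < u)%N by case: u Ez => // Ez; move: zn1; rewrite Ez expr1n eqxx.
have [a co_a Ha] := Hd m n.+1.
have [|y yth yu] := @conj_lift _ _ k0 th u (z ^+ a) (k0_alg th) u_gt0.
  by move=> r; rewrite -Ez; apply: (cyclo_pp_conj zn zn1 co_a).
have [|[s _] /= Ey] := prim_rootP th_prim (_ : y ^+ N = 1).
  have := yth ('X^N - 1); rewrite rmorphB /= map_polyXn rmorph1 !rootE.
  rewrite !hornerD !hornerN !hornerC !hornerXn (prim_expr_order th_prim) subrr => /(_ (eqxx _)).
  by rewrite subr_eq0 => /eqP.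
have ths : conj_over th (th ^+ s) by rewrite -Ey.
have co_s := conj_prim_coprime th_prim ths.
exists (th ^+ (s ^ totient m0)); split; first exact: conj_overX.
  rewrite exprAC -Ez -(expr_mod _ zn) -Ha (expr_mod _ zn).
  have zs : z ^+ s = z ^+ a by rewrite -yu Ey Ez exprAC.
  elim: (totient m0) => [|t IHt]; first by rewrite !expn0.
  by rewrite !expnSr !exprM IHt [LHS]exprAC zs exprAC.
rewrite exprAC -Exi -(expr_mod _ (prim_expr_order xi_prim)) Euler_exp_totient.
  by rewrite (expr_mod _ (prim_expr_order xi_prim)) expr1.
by apply: coprime_dvdr co_s; rewrite dvdn_mull.
Qed.

End Conjugation.

(** * Denominators of integers and algebraicity over Z_p[[T]] *)

Lemma denom_exchange (F : fieldType) (e t c c' h : F) : c != 0 -> c' != 0 ->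
  e * (t / c * h) = t * (e * (h / (c * c'))) * c'.
Proof. by move=> c0 c0'; field; apply/andP. Qed.

Lemma frac_common_denom (R : idomainType) (I : finType) (x : I -> {fraction R}) :
  exists2 e : R, e != 0 & forall i, exists r, tofrac e * x i = tofrac r.
Proof.
have Hd i : exists d : R, d != 0 /\ exists r, tofrac d * x i = tofrac r.
  have [a [b [b0 ->]]] := frac_numden (x i); exists b; split=> //; exists a.
  by rewrite mulrC divfK // tofrac_eq0.
pose d i := sval (cid (Hd i)).
have dP i : d i != 0 /\ exists r, tofrac (d i) * x i = tofrac r by rewrite /d; case: cid.
exists (\prod_i d i) => [|i]; first by apply/prodf_neq0 => i _; case: (dP i).
have [_ [r Hr]] := dP i; exists (r * \prod_(j | j != i) d j).
by rewrite (bigD1 i) //= !tofracM mulrAC Hr.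
Qed.

Lemma frac_alg_inj (R : idomainType) (E : fieldExtType {fraction R}) : injective (frac_alg E).
Proof. by move=> x y /(fmorph_inj (in_alg E))/eqP; rewrite tofrac_eq => /eqP. Qed.

(** * The trace form of a finite extension and denominators of integral elements *)

Section TraceForm.
Variables (R : idomainType) (K : fieldExtType {fraction R}) (C : closedFieldType).
Variable iota : {rmorphism K -> C}.
Local Notation F := {fraction R}.
Local Notation d := (\dim {:K}).
Local Notation b := (vbasis {:K}).

Definition mulmat (a : K) : 'M[F]_d := \matrix_(i, j) coord b j (a * b`_i).

Lemma coordE (a : K) : a = \sum_(j < d) coord b j a *: b`_j.
Proof. by apply: coord_vbasis; rewrite memvf. Qed.

Lemma mulmatM a a' : mulmat (a' * a) = mulmat a *m mulmat a'.
Proof.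
apply/matrixP => i j; rewrite !mxE -mulrA [a * b`_i]coordE mulr_sumr linear_sum /=.
by apply: eq_bigr => l _; rewrite !mxE -scalerAr linearZ.
Qed.

Lemma mulmatD a a' : mulmat (a + a') = mulmat a + mulmat a'.
Proof. by apply/matrixP => i j; rewrite !mxE mulrDl linearD. Qed.

Lemma mulmatZ (c : F) a : mulmat (c *: a) = c *: mulmat a.
Proof. by apply/matrixP => i j; rewrite !mxE -scalerAl linearZ. Qed.

Lemma mulmat0 : mulmat 0 = 0.
Proof. by apply/matrixP => i j; rewrite !mxE mul0r linear0. Qed.

Lemma mulmat1 : mulmat 1 = 1%:M.
Proof.
apply/matrixP => i j; rewrite !mxE mul1r coord_free ?(basis_free (vbasisP _)) //.
Qed.

Definition ktrace (a : K) : F := \tr (mulmat a).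

Lemma ktraceD a a' : ktrace (a + a') = ktrace a + ktrace a'.
Proof. by rewrite /ktrace mulmatD mxtraceD. Qed.
Lemma ktraceZ c a : ktrace (c *: a) = c * ktrace a.
Proof. by rewrite /ktrace mulmatZ mxtraceZ. Qed.
Lemma ktrace_sum I (s : seq I) (x : I -> K) : ktrace (\sum_(i <- s) x i) = \sum_(i <- s) ktrace (x i).
Proof.
elim: s => [|y s IHs]; rewrite ?big_nil ?big_cons ?ktraceD ?IHs //.
by rewrite /ktrace mulmat0 mxtrace0.
Qed.

Let f : {rmorphism F -> C} := (iota \o in_alg K : {rmorphism F -> C}).
Let g : {rmorphism R -> C} := (f \o @tofrac R : {rmorphism R -> C}).

(** An equation of [a] annihilates its multiplication matrix, hence the eigenvalues; so integrality
    of [a] passes to them and to the trace. *)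
Lemma mulmat_eigen (a : K) (l : C) (q : {poly R}) : root (map_poly (frac_alg K) q) a ->
  root (char_poly (map_mx f (mulmat a))) l -> root (map_poly g q) l.
Proof.
rewrite -eigenvalue_root_char => /rootP qa /eigenvalueP[v Ev v0].
have Evi i : v *m map_mx f (mulmat (a ^+ i)) = l ^+ i *: v.
  elim: i => [|i IHi]; first by rewrite !expr0 mulmat1 map_mx1 mulmx1 scale1r.
  by rewrite exprSr mulmatM map_mxM mulmxA Ev -scalemxAl IHi scalerA -exprS.
have E0 : mulmat (\sum_(i < size q) tofrac q`_i *: a ^+ i) = 0.
  rewrite -[RHS]mulmat0; congr mulmat; rewrite -[RHS]qa.
  rewrite (@horner_coef_wide _ (size q)) ?size_poly //; apply: eq_bigr => i _.
  by rewrite coef_map /= mulr_algl.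
have E1 : v *m map_mx f (mulmat (\sum_(i < size q) tofrac q`_i *: a ^+ i)) = (map_poly g q).[l] *: v.
  rewrite (@horner_coef_wide _ (size q)) ?size_poly // scaler_suml.
  elim/big_ind2: _ => [|x1 x2 y1 y2 E1 E2|i _]; first by rewrite mulmat0 map_mx0 mulmx0.
    by rewrite mulmatD map_mxD mulmxDr E1 E2.
  by rewrite mulmatZ map_mxZ -scalemxAr Evi scalerA coef_map.
move: E1; rewrite E0 map_mx0 mulmx0 => /esym/eqP.
by rewrite scaler_eq0 (negPf v0) orbF.
Qed.

Hypothesis closedR : forall x : F, integralOver g (f x) -> exists r, x = tofrac r.
Hypothesis charF : d%:R != 0 :> F.

Lemma finite_ext_scale (x : K) : exists2 c : R, c != 0 & integralOver (frac_alg K) (tofrac c *: x).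
Proof.
have [q q_mon qx] := alg_integral x.
have [r [c [c0 r0 Er]]] := frac_clear (monic_neq0 q_mon).
have rx : root (map_poly (frac_alg K) r) x.
  by rewrite map_poly_comp Er map_polyZ rootE hornerZ (rootP qx) mulr0.
exists (lead_coef r); first by rewrite lead_coef_eq0.
rewrite -mulr_algl; apply: lead_coef_integral => //.
have <- : size (map_poly (frac_alg K) r) = size r.
  by apply: size_map_inj_poly; [apply: frac_alg_inj | rewrite rmorph0].
apply: root_size_gt1 rx; rewrite map_poly_comp Er map_polyZ scaler_eq0 negb_or.
by rewrite fmorph_eq0 tofrac_eq0 c0 map_poly_eq0 monic_neq0.
Qed.

Lemma ktrace_integral a : integralOver (frac_alg K) a -> exists r, ktrace a = tofrac r.
Proof.
move=> [q q_mon qa]; apply: closedR; rewrite /ktrace -trace_map_mx.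
set A := map_mx f _; have d_gt0 : (0 < d)%N by rewrite lt0n; apply: contraNneq charF => ->.
have := char_poly_trace A d_gt0; have [rs Ers] := closed_field_poly_normal (char_poly A).
rewrite (monicP (char_poly_monic A)) scale1r in Ers.
have srs : size rs = d by have := size_char_poly A; rewrite Ers size_prod_XsubC => -[].
have rs0 : size rs != 0%N by rewrite srs -lt0n.
rewrite Ers -{1}srs (coefPn_prod_XsubC rs0) => /eqP; rewrite eqr_opp => /eqP <-.
have int_rs r : r \in rs -> r \in integral_over_pred g.
  move=> rin; apply/asboolP; exists q => //; apply: (mulmat_eigen qa).
  by rewrite -/A Ers root_prod_XsubC.
suff : \sum_(r <- rs) r \in integral_over_pred g by move/asboolP.
by rewrite big_seq rpred_sum.
Qed.

Definition gram : 'M[F]_d := \matrix_(i, j) ktrace (b`_i * b`_j).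

(** The trace form is nondegenerate because [x * x^-1] has trace [d], which is nonzero. *)
Lemma gram_unit : gram \in unitmx.
Proof.
rewrite unitmxE unitfE; apply/negP => /det0P[v v0 vG].
pose x := \sum_(i < d) v 0 i *: b`_i.
have x0 : x != 0.
  apply: contraNneq v0 => x0; apply/eqP/rowP => i; rewrite mxE.
  have /freeP/(_ (v 0)) := basis_free (vbasisP {:K}); apply.
  by rewrite -[RHS]x0; apply: eq_bigr.
have xb (j : 'I_d) : ktrace (x * b`_j) = 0.
  have := congr1 (fun m => fun_of_matrix m 0 j) vG; rewrite !mxE => <-.
  rewrite /x mulr_suml ktrace_sum; apply: eq_bigr => i _.
  by rewrite mxE -scalerAl ktraceZ.
have xy y : ktrace (x * y) = 0.
  rewrite [y]coordE mulr_sumr ktrace_sum big1 // => j _.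
  by rewrite -scalerAr ktraceZ xb mulr0.
have := xy x^-1; rewrite mulfV // /ktrace mulmat1 mxtrace1 => /eqP.
by rewrite (negPf charF).
Qed.

(** The coordinates of [a] in an integral basis [w] come from the traces of the [a * w j], which lie
    in [R], by the inverse Gram matrix of [w]; [e] clears the denominators of this matrix, whatever
    [a] is. *)
Lemma integral_denominators : exists (e : R) (w : 'I_d -> K),
  [/\ e != 0, forall i, integralOver (frac_alg K) (w i) &
      forall a, integralOver (frac_alg K) a ->
        exists c : 'I_d -> R, tofrac e *: a = \sum_i tofrac (c i) *: w i].
Proof.
pose c0 (i : 'I_d) := sval (cid2 (finite_ext_scale b`_i)).
have c0P i : c0 i != 0 /\ integralOver (frac_alg K) (tofrac (c0 i) *: b`_i).
  by rewrite /c0; case: cid2.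
pose w (i : 'I_d) := tofrac (c0 i) *: b`_i.
pose H := invmx gram; pose D : 'M[F]_d := \matrix_(i, j) (H i j / (tofrac (c0 i) * tofrac (c0 j))).
have [e e0 He] := frac_common_denom (fun ij => D ij.1 ij.2).
exists e, w; split=> // [i|a a_int]; first by case: (c0P i).
have Ht j : exists t, ktrace (a * w j) = tofrac t.
  apply: ktrace_integral; apply: integral_mul => //; by case: (c0P j).
pose t j := sval (cid (Ht j)).
have tE j : ktrace (a * w j) = tofrac (t j) by rewrite /t; case: cid.
pose h i j := sval (cid (He (i, j))).
have hE i j : tofrac e * D i j = tofrac (h i j) by rewrite /h; case: cid.
have tc0 i : tofrac (c0 i) != 0 by rewrite tofrac_eq0; case: (c0P i).
exists (fun i => \sum_j t j * h j i).
pose av : 'rV[F]_d := \row_i coord b i a.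
pose tv : 'rV[F]_d := \row_j (tofrac (t j) / tofrac (c0 j)).
have avG : av *m gram = tv.
  apply/rowP => j; rewrite !mxE -tE /w -scalerAr ktraceZ mulrAC mulfV // mul1r.
  rewrite [X in _ = ktrace (X * _)]coordE mulr_suml ktrace_sum; apply: eq_bigr => i _.
  by rewrite !mxE -scalerAl ktraceZ.
have avE : av = tv *m H by rewrite -avG mulmxK ?gram_unit.
rewrite {1}[a]coordE scaler_sumr; apply: eq_bigr => i _; rewrite scalerA /w scalerA.
congr (_ *: _); have -> : coord b i a = av 0 i by rewrite mxE.
rewrite avE mxE mulr_sumr rmorph_sum mulr_suml; apply: eq_bigr => j _.
rewrite rmorphM /= -hE !mxE.
exact: denom_exchange.
Qed.

End TraceForm.

Section LambdaAlgebraic.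
Variables (p : nat) (p_pr : prime p) (K : fieldExtType (padic p_pr)).
Variables (C : closedFieldType) (iota : {rmorphism K -> C}).
Variable L : fieldExtType {fraction Lambda K}.
Local Notation Zp := (padic_int p_pr).
Local Notation L0 := (power_series Zp).

Definition base_emb : {rmorphism padic p_pr -> C} := (iota \o in_alg K : {rmorphism padic p_pr -> C}).

Lemma integers_denominators : exists (n : nat) (e : Zp) (w : 'I_n -> ring_of_integers K),
  e != 0 /\ forall a : ring_of_integers K, exists c : 'I_n -> Zp,
    ic_in (frac_alg K) e * a = \sum_i ic_in (frac_alg K) (c i) * w i.
Proof.
have [||e [w [e0 w_int H]]] := @integral_denominators Zp K C iota.
- by move=> x x_int; apply: (@zbar_padic _ _ _ base_emb); apply/asboolP.
- rewrite -(rmorph_nat (@tofrac Zp)) tofrac_eq0 padic_nat_neq0 // adim_gt0 //.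
have w_mem i : w i \in integral_over_pred (frac_alg K) by apply/asboolP.
exists (\dim {:K}), e, (fun i => IntegralClosure (w_mem i)); split=> // a.
have [|c Hc] := H (val a); first by apply/asboolP; case: a.
exists c; apply: val_inj; rewrite rmorphM rmorph_sum /= mulr_algl Hc.
by apply: eq_bigr => i _; rewrite /= mulr_algl.
Qed.

Definition ps_emb : {rmorphism L0 -> Lambda K} :=
  (map_ps (@ic_in _ _ (frac_alg K)) : {rmorphism L0 -> Lambda K}).
Definition ps_field_emb : {rmorphism L0 -> L} := (frac_alg L \o ps_emb : {rmorphism L0 -> L}).

Lemma ps_field_emb_inj : injective ps_field_emb.
Proof.
move=> f g /frac_alg_inj E; apply: power_seriesP => n.
have /(congr1 val)/frac_alg_inj // := congr1 (fun h => coefps h n) E.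
Qed.

(** As [e] serves all coefficients of [h] at once, [e h] is a combination over [Z_p[[T]]] of the
    finitely many constants [w i]. *)
Lemma Lambda_algebraic (h : Lambda K) : algebraicOver (frac_ext ps_field_emb_inj) (frac_alg L h).
Proof.
have [n [e [w [e0 H]]]] := integers_denominators.
pose c j := sval (cid (H (coefps h j))).
have cE j : ic_in (frac_alg K) e * coefps h j = \sum_i ic_in (frac_alg K) (c j i) * w i.
  by rewrite /c; case: cid.
have constM (a : ring_of_integers K) (g : Lambda K) j : coefps (ps_const a * g) j = a * coefps g j.
  rewrite coefpsM big_ord_recl /= subn0 big1 ?addr0 // => i _.
  by rewrite mul0r.
have E1 : ps_emb (ps_const e) * h = \sum_i ps_emb (PowerSeries (fun j => c j i)) * ps_const (w i).
  apply: power_seriesP => j; rewrite coefps_sum.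
  have -> : ps_emb (ps_const e) = ps_const (ic_in (frac_alg K) e).
    by apply: power_seriesP => -[|j'] //=; rewrite rmorph0.
  rewrite constM cE; apply: eq_bigr => i _.
  by rewrite [X in coefps X _]mulrC constM mulrC.
have e0' : ps_field_emb (ps_const e) != 0.
  rewrite -(rmorph0 ps_field_emb) (inj_eq ps_field_emb_inj).
  by apply: contraNneq e0 => /(congr1 (fun g => coefps g 0)) /= ->.
have -> : frac_alg L h = (\sum_i ps_field_emb (PowerSeries (fun j => c j i)) *
    frac_alg L (ps_const (w i))) / ps_field_emb (ps_const e).
  apply: (mulIf e0'); rewrite divfK // mulrC.
  transitivity (frac_alg L (ps_emb (ps_const e) * h)); first by rewrite rmorphM.
  by rewrite E1 rmorph_sum; apply: eq_bigr => i _; rewrite rmorphM.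
apply: algebraic_div; last by rewrite -(frac_ext_tofrac ps_field_emb_inj); apply: algebraic_id.
apply/integral_algebraic.
suff : (\sum_i ps_field_emb (PowerSeries (fun j => c j i)) * frac_alg L (ps_const (w i)))
    \in integral_over_pred (frac_ext ps_field_emb_inj) by move/asboolP.
apply: rpred_sum => i _; apply: rpredM.
  by apply/asboolP; rewrite -(frac_ext_tofrac ps_field_emb_inj); apply: integral_id.
apply/asboolP/integral_algebraic/frac_algP.
have [q q_mon qw] : integralOver (frac_alg K) (val (w i)) by apply/asboolP; case: (w i).
pose cst0 : {rmorphism Zp -> L0} := (@ps_of_poly Zp \o polyC : {rmorphism Zp -> L0}).
pose cst : {rmorphism ring_of_integers K -> Lambda K} :=
  (@ps_of_poly (ring_of_integers K) \o polyC : {rmorphism ring_of_integers K -> Lambda K}).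
exists (map_poly cst0 q).
  by rewrite monic_neq0 // monic_map.
have qw0 : (map_poly (ic_in (frac_alg K)) q).[w i] = 0.
  apply: val_inj; rewrite rmorph0 -horner_map -map_poly_comp.
  by rewrite -[RHS](rootP qw); congr (_.[_]); apply: eq_map_poly.
have -> : ps_const (w i) = cst (w i) by rewrite /cst /= ps_of_polyC.
have -> : map_poly ps_field_emb (map_poly cst0 q) =
    map_poly (frac_alg L \o cst) (map_poly (ic_in (frac_alg K)) q).
  rewrite -!map_poly_comp; apply: eq_map_poly => a.
  have Ea : ps_emb (cst0 a) = cst (ic_in (frac_alg K) a).
    by apply: power_seriesP => j; rewrite /= !coefC; case: (j == 0%N); rewrite ?rmorph0.
  exact: (congr1 (frac_alg L) Ea).
by rewrite rootE -[frac_alg L (cst _)]/((frac_alg L \o cst) _) horner_map qw0 rmorph0.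
Qed.

Lemma iclosure_algebraic (h : iclosure_Lambda L) : exists2 q : {poly L0},
  q != 0 & root (map_poly (ic_in (frac_alg L) \o ps_emb) q) h.
Proof.
have [q q_mon qh] : integralOver (frac_alg L) (val h) by apply/asboolP; case: h.
have : integralOver (frac_ext ps_field_emb_inj) (val h).
  apply: integral_root_monic qh _; first by rewrite monic_map.
  move=> _ /(nthP 0)[i _ <-]; rewrite coef_map; apply/integral_algebraic.
  exact: Lambda_algebraic.
move=> /integral_algebraic/frac_algP[r r0 rh]; exists r => //.
rewrite rootE; apply/eqP/val_inj; rewrite rmorph0 -horner_map -map_poly_comp.
by rewrite -[RHS](rootP rh); congr (_.[_]); apply: eq_map_poly.
Qed.

Lemma iclosure_algebraic_const (h : iclosure_Lambda L) : h != 0 -> exists2 q : {poly L0},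
  q`_0 != 0 & root (map_poly (ic_in (frac_alg L) \o ps_emb) q) h.
Proof.
move=> h0; have [q q0 qh] := iclosure_algebraic h.
have vh : root (map_poly ps_field_emb q) (val h).
  have := congr1 val (rootP qh); rewrite rmorph0 -horner_map -map_poly_comp => E.
  by apply/eqP; rewrite -[RHS]E; congr (_.[_]); apply: eq_map_poly.
have [|r r0 rh] := @root_const_neq0 _ _ ps_field_emb (val h) _ (ex_intro2 _ _ q q0 vh).
  by rewrite -(inj_eq val_inj) rmorph0 in h0.
exists r => //; rewrite rootE; apply/eqP/val_inj; rewrite rmorph0 -horner_map -map_poly_comp.
by rewrite -[RHS](rootP rh); congr (_.[_]); apply: eq_map_poly.
Qed.

End LambdaAlgebraic.

(** * Ultraproducts and Prony's method *)

Section Ultraproduct.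
Variables (C : fieldType) (U : set_system nat).

Definition uzero (HU : UltraFilter U) : {pred (nat -> C)} :=
  fun u => `[< U [set n | u n = 0] >].

Variable HU : UltraFilter U.

Fact uzero_idealr_closed : idealr_closed (uzero HU).
Proof.
split=> [||a u v /asboolP Uu /asboolP Uv].
- by apply/asboolP; apply: filterS filterT.
- apply/negP => /asboolP H; have [n] := filter_ex H.
  by move=> /eqP; rewrite oner_eq0.
- apply/asboolP; near=> n.
  have un : u n = 0 by near: n.
  have vn : v n = 0 by near: n.
  by rewrite /= -[(a * u + v) n]/(a n * u n + v n) un vn mulr0 addr0.
Unshelve. all: by end_near.
Qed.
HB.instance Definition _ := isIdealr.Build (nat -> C) (uzero HU) uzero_idealr_closed.

Fact uzero_prime : prime_idealr_closed (uzero HU).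
Proof.
move=> u v /asboolP Uuv; apply/orP.
have [Uu|Uu] := in_ultra_setVsetC [set n | u n = 0] HU; first by left; apply/asboolP.
right; apply/asboolP; near=> n.
have un : u n <> 0 by near: n.
have : u n * v n = 0 by near: n.
by move=> /eqP; rewrite mulf_eq0 => /orP[/eqP//|/eqP].
Unshelve. all: by end_near.
Qed.
HB.instance Definition _ := isPrimeIdealrClosed.Build (nat -> C) (uzero HU) uzero_prime.

Definition udomain := {ideal_quot uzero HU}.
HB.instance Definition _ := GRing.ComNzRing.on udomain.
HB.instance Definition _ := ComNzRing_isClassicalDomain.Build udomain
  (@Quotient.rquot_IdomainAxiom _ (uzero HU)).

Lemma ultraproduct_exists : exists (KK : fieldType) (cls : {rmorphism (nat -> C) -> KK}),
  forall u, cls u = 0 <-> U [set n | u n = 0].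
Proof.
pose q : {rmorphism (nat -> C) -> udomain} := (\pi_({ideal_quot (uzero HU)})%qT : {rmorphism (nat -> C) -> {ideal_quot (uzero HU)}}).
exists {fraction udomain}, (@tofrac udomain \o q : {rmorphism (nat -> C) -> {fraction udomain}}) => u.
have -> : (tofrac (q u) = 0) <-> (q u = 0).
  split=> [/eqP|->]; last by rewrite tofrac0.
  by rewrite tofrac_eq0 => /eqP.
rewrite -(rmorph0 q); split=> [/eqP|H].
  by rewrite -Quotient.idealrBE subr0 => /asboolP.
by apply/eqP; rewrite -Quotient.idealrBE subr0; apply/asboolP.
Qed.

End Ultraproduct.

Section Prony.
Variables (F E : fieldType) (f : {rmorphism F -> E}).

(** The Hankel matrix of the power sums is singular, the coefficients of [\prod_i (X - y i)] being
    in its kernel; its entries being algebraic, it also has a kernel vector with algebraic entries,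
    read as a polynomial [W1]. Then [\sum_j g j * q.[y j] * W1.[y j] = 0] for all [q] of degree at
    most [B]; a [q] vanishing at the other values isolates [y l] and gives [W1.[y l] = 0]. Equal
    [y i] cannot be separated, whence the hypothesis on the sum over their group. *)
Lemma prony B (y g : 'I_B -> E) :
    (forall m, algebraicOver f (\sum_i g i * y i ^+ m)) ->
  forall l, \sum_(i | y i == y l) g i != 0 -> algebraicOver f (y l).
Proof.
move=> u_alg l Gl; pose A := integral_closure f.
have u_mem m : \sum_i g i * y i ^+ m \in integral_over_pred f.
  by apply/asboolP/integral_algebraic.
pose u m : A := IntegralClosure (u_mem m).
pose H : 'M[A]_B.+1 := \matrix_(i, j) u (i + j)%N.
have sumP (q : {poly E}) m : (size q <= B.+1)%N ->
    \sum_(i < B.+1) q`_i * val (u (i + m)%N) = \sum_l g l * y l ^+ m * q.[y l].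
  move=> sq; under eq_bigr do rewrite /= mulr_sumr.
  rewrite exchange_big /=; apply: eq_bigr => j _.
  rewrite (horner_coef_wide _ sq) mulr_sumr; apply: eq_bigr => i _.
  by rewrite exprD; ring.
have detH : \det H = 0.
  apply: val_inj; rewrite rmorph0 -det_map_mx; apply/eqP/det0P.
  pose W := \prod_(i < B) ('X - (y i)%:P).
  have sW : size W = B.+1 by rewrite size_prod_XsubC /index_enum -enumT size_enum_ord.
  exists (\row_i W`_i).
    apply/eqP => /rowP/(_ ord_max); rewrite !mxE /= => /eqP.
    have : lead_coef W = 1 by apply/monicP/monic_prod_XsubC.
    by rewrite lead_coefE sW /= => ->; rewrite oner_eq0.
  apply/rowP => j; rewrite !mxE.
  under eq_bigr do rewrite !mxE; rewrite sumP ?sW // big1 // => i _.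
  by rewrite /W horner_prod (bigD1 i) //= hornerXsubC subrr mul0r mulr0.
have [w w0 wH] := elimT det0P (introT eqP detH).
pose W1 : {poly E} := \poly_(i < B.+1) val (w 0 (inord i)).
have W1i (i : 'I_B.+1) : W1`_i = val (w 0 i) by rewrite coef_poly ltn_ord inord_val.
have sW1 : (size W1 <= B.+1)%N by apply: size_poly.
have W1sum m : (m <= B)%N -> \sum_j g j * y j ^+ m * W1.[y j] = 0.
  move=> le_m; have lt_m : (m < B.+1)%N by rewrite ltnS.
  rewrite -sumP //; have := congr1 (fun M => val (fun_of_matrix M 0 (Ordinal lt_m))) wH.
  rewrite !mxE => E0; transitivity (val (\sum_i w 0 i * H i (Ordinal lt_m))).
    by rewrite rmorph_sum; apply: eq_bigr => i _; rewrite W1i rmorphM !mxE.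
  by rewrite E0 rmorph0.
pose zs := [seq z <- undup [seq y i | i <- enum 'I_B] | z != y l].
pose q := \prod_(z <- zs) ('X - z%:P).
have sq : (size q <= B.+1)%N.
  rewrite size_prod_XsubC ltnS size_filter (leq_trans (count_size _ _)) //.
  by rewrite (leq_trans (size_undup _)) // size_map size_enum_ord.
have qsum : \sum_j g j * q.[y j] * W1.[y j] = 0.
  under eq_bigr => j _ do rewrite (horner_coef_wide _ sq) mulr_sumr mulr_suml.
  rewrite exchange_big /= big1 // => i _.
  transitivity (q`_i * \sum_j g j * y j ^+ i * W1.[y j]); last first.
    by rewrite W1sum ?mulr0 // -ltnS.
  by rewrite mulr_sumr; apply: eq_bigr => j _; ring.
have qy j : q.[y j] != 0 = (y j == y l).
  apply/idP/idP => [|/eqP->].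
    apply: contraNT => ne; apply/eqP/rootP; rewrite root_prod_XsubC mem_filter ne mem_undup.
    by rewrite map_f ?mem_enum.
  by apply/negP => /eqP/rootP; rewrite root_prod_XsubC mem_filter eqxx.
have : (\sum_(i | y i == y l) g i) * (q.[y l] * W1.[y l]) = 0.
  rewrite -[RHS]qsum [in RHS](bigID (fun j => y j == y l)) /= [X in _ = _ + X]big1 ?addr0.
    by rewrite mulr_suml; apply: eq_bigr => i /eqP->; rewrite mulrA.
  by move=> i; rewrite -qy negbK => /eqP->; rewrite mulr0 mul0r.
move=> /eqP; rewrite !mulf_eq0 (negPf Gl) (negPf (_ : q.[y l] != 0)) ?qy //= => W1y.
apply/integral_algebraic; apply: (integral_root (p := W1)) => //.
  apply: contraNneq w0 => W10; apply/eqP/rowP => i; rewrite mxE.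
  by apply: val_inj; rewrite -W1i W10 coef0 rmorph0.
by move=> _ /(nthP 0)[i _ <-]; rewrite coef_poly; case: ifP => _;
  [apply/asboolP; case: (w 0 _) | apply: integral0].
Qed.

Lemma algebraic_root_exp x n : (0 < n)%N -> algebraicOver f (x ^+ n) -> algebraicOver f x.
Proof.
move=> n_gt0 /integral_algebraic xn; apply/integral_algebraic.
apply: (integral_root_monic (p := 'X^n - (x ^+ n)%:P)); first by rewrite monicXnsubC.
  by rewrite rootE hornerD hornerN hornerC hornerXn subrr.
apply/integral_poly => i; rewrite coefB coefXn coefC.
apply: integral_sub; first exact: integral_nat.
by case: ifP => _ //; apply: integral0.
Qed.

End Prony.

(** * The identity along an ultrafilter *)

Lemma ultra_finite (U : set_system nat) (HU : UltraFilter U) m (h : nat -> nat) :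
  U [set i | (h i < m)%N] -> exists v, U [set i | h i = v].
Proof.
elim: m => [|m IHm] Um.
  by have [i] := filter_ex Um.
have [Uh|Uh] := in_ultra_setVsetC [set i | h i = m] HU; first by exists m.
apply: IHm; near=> i.
have : (h i < m.+1)%N by near: i.
rewrite ltnS leq_eqVlt => /orP[/eqP hi|//].
have : h i <> m by near: i.
by rewrite hi.
Unshelve. all: by end_near.
Qed.

Section RelationPolynomial.
Variables (F C : fieldType) (f : {rmorphism F -> C}) (B M u v : nat).
Variables (r : nat -> {poly F}) (c : 'I_B -> {poly F}) (e : 'I_B -> nat).

(** With [z = th ^ u] and [xi = th ^ v], its value at [th] is that of the relation satisfied by [F],
    the [r j] computing the coefficients at [z - 1]. Being a polynomial over the base field in [th]
    alone, it can be conjugated. *)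
Definition relation_poly : {poly F} :=
  \sum_(j < M) (r j \Po ('X^u - 1)) * (\sum_i (c i \Po 'X^v) * 'X^u ^+ e i) ^+ j.

Lemma relation_polyE x : (map_poly f relation_poly).[x] =
  \sum_(j < M) (map_poly f (r j)).[x ^+ u - 1] *
    (\sum_i (map_poly f (c i)).[x ^+ v] * (x ^+ u) ^+ e i) ^+ j.
Proof.
rewrite rmorph_sum horner_sum; apply: eq_bigr => j _.
rewrite rmorphM hornerM /= map_comp_poly horner_comp rmorphB /= map_polyXn rmorph1.
rewrite hornerD hornerN hornerC hornerXn rmorphXn horner_exp rmorph_sum horner_sum.
congr (_ * _ ^+ _); apply: eq_bigr => i _.
by rewrite -!exprM rmorphM hornerM /= map_comp_poly horner_comp !map_polyXn !hornerXn.
Qed.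

End RelationPolynomial.

Section Core.
Variables (p : nat) (p_pr : prime p) (C : closedFieldType).
Variable k0 : {rmorphism padic p_pr -> C}.
Hypothesis k0_alg : forall x : C, algebraicOver k0 x.
Local Notation Zp := (padic_int p_pr).
Local Notation L0 := (power_series Zp).
Local Notation k := (padic_emb k0).
Variables (U : set_system nat) (HU : UltraFilter U).
Variables (E : nat -> {rmorphism L0 -> C}) (z : nat -> C) (n : nat -> nat).
Hypothesis Ez : forall i, is_point k0 (E i) (z i) (n i).
Hypothesis z_large : forall l, U [set i | z i ^+ (p ^ l) != 1].
Variables (KK : fieldType) (cls : {rmorphism (nat -> C) -> KK}).
Hypothesis cls0 : forall u, cls u = 0 <-> U [set i | u i = 0].

Lemma cls_eq u v : cls u = cls v <-> U [set i | u i = v i].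
Proof.
have -> : (cls u = cls v) <-> (cls (u - v) = 0).
  rewrite rmorphB; split=> [->|/eqP]; first by rewrite subrr.
  by rewrite subr_eq0 => /eqP.
rewrite cls0; split; apply: filterS => i /=.
  by rewrite -[(u - v) i]/(u i - v i) => /eqP; rewrite subr_eq0 => /eqP.
by rewrite -[(u - v) i]/(u i - v i) => ->; rewrite subrr.
Qed.

Definition point_family (f : L0) : nat -> C := fun i => E i f.

Fact point_family_is_zmod_morphism : zmod_morphism point_family.
Proof. by move=> f g; apply/funext => i; rewrite /point_family rmorphB. Qed.
Fact point_family_is_monoid_morphism : monoid_morphism point_family.
Proof.
split=> [|f g]; apply/funext => i; rewrite /point_family; first exact: rmorph1.
exact: rmorphM.
Qed.
HB.instance Definition _ := GRing.isZmodMorphism.Build L0 (nat -> C) point_family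
  point_family_is_zmod_morphism.
HB.instance Definition _ := GRing.isMonoidMorphism.Build L0 (nat -> C) point_family
  point_family_is_monoid_morphism.

Definition evK : {rmorphism L0 -> KK} := (cls \o point_family : {rmorphism L0 -> KK}).

Lemma evKE f : evK f = cls (fun i => E i f). Proof. by []. Qed.

Lemma evK_inj : injective evK.
Proof.
move=> f g /eqP; rewrite -subr_eq0 -rmorphB => /eqP/cls0 H.
apply/eqP; rewrite -subr_eq0; apply: contraT => /(point_neq0 k0)[l Hl].
have [i [Hi /=]] := filter_ex (filterI (z_large l) H).
by move=> /eqP; rewrite (negPf (Hl _ _ _ (Ez i) Hi)).
Qed.

Local Notation alg := (algebraicOver (frac_ext evK_inj)).

Lemma alg_ev f : alg (evK f).
Proof. by rewrite -(frac_ext_tofrac evK_inj); apply: algebraic_id. Qed.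

Lemma fctX (x : nat -> C) j i : (x ^+ j) i = x i ^+ j.
Proof. by elim: j => // j IHj; rewrite !exprS -IHj. Qed.

Lemma cls_horner (Q : {poly L0}) (x : nat -> C) :
  (map_poly evK Q).[cls x] = cls (fun i => (map_poly (E i) Q).[x i]).
Proof.
rewrite (@horner_coef_wide _ (size Q)) ?size_poly //.
transitivity (cls (\sum_(j < size Q) point_family Q`_j * x ^+ j)).
  by rewrite rmorph_sum; apply: eq_bigr => j _; rewrite rmorphM rmorphXn coef_map.
apply: (congr1 cls); apply/funext => i.
rewrite fct_sumE (@horner_coef_wide _ (size Q)) ?size_poly //.
apply: eq_bigr => j _; rewrite coef_map -fctX.
by [].
Qed.

Lemma alg_family (x : nat -> C) : alg (cls x) <->
  exists2 Q : {poly L0}, Q != 0 & U [set i | (map_poly (E i) Q).[x i] = 0].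
Proof.
rewrite frac_algP; split=> -[Q Q0 H]; exists Q => //.
  by apply/cls0; rewrite -cls_horner; apply/rootP.
by rewrite rootE cls_horner; apply/eqP/cls0.
Qed.

Lemma standard_part (e : nat -> nat) : exists e0 : Zp,
  forall N, U [set i | (e i %% p ^ N)%N = e0 N].
Proof.
have pN N : (0 < p ^ N)%N by rewrite expn_gt0 prime_gt0.
have ex N : exists r, U [set i | (e i %% p ^ N)%N = r].
  by apply: (ultra_finite HU (m := p ^ N)); apply: filterS filterT => i _ /=; rewrite ltn_mod.
pose r N := sval (cid (ex N)).
have rP N : U [set i | (e i %% p ^ N)%N = r N] by rewrite /r; case: cid.
have coh : coherent p r.
  apply/asboolP => N; have [i [/= <- <-]] := filter_ex (filterI (rP N) (rP N.+1)).
  by rewrite modn_dvdm // dvdn_exp2l.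
by exists (PadicInt p_pr coh).
Qed.

Lemma point_order_large i l : z i ^+ (p ^ l) != 1 -> (l < n i)%N.
Proof.
move=> H; rewrite ltnNge; apply: contra H => le.
by rewrite -(subnKC le) expnD exprM (point_unity (Ez i)) expr1n.
Qed.

Lemma alg_unity (e : nat -> nat) : alg (cls (fun i => z i ^+ e i)) ->
  exists (eta : C) (e0 : Zp), (exists L, eta ^+ (p ^ L) = 1) /\
    U [set i | z i ^+ e i = eta * E i (one_plus_T_pow e0)].
Proof.
move=> X_alg; have [e0 He0] := standard_part e.
(* [d i] represents [e i - e0] modulo [p ^ n i]; adding [p ^ n i] keeps it a natural number. *)
pose d i := (e i + (p ^ n i - e0 (n i)))%N; pose Y i := z i ^+ d i.
have pN N : (0 < p ^ N)%N by rewrite expn_gt0 prime_gt0.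
have XY : U [set i | z i ^+ e i = Y i * E i (one_plus_T_pow e0)].
  apply: filterS (z_large 0) => i /=; rewrite expn0 expr1 => z1.
  rewrite (point_one_plus_T_pow k0_alg (Ez i) z1) /Y -exprD /d -addnA subnK ?residue_le //.
  by rewrite exprD (point_unity (Ez i)) mulr1.
have d_dvd N : U [set i | (p ^ N %| d i)%N].
  apply: filterS (filterI (He0 N) (z_large N)) => i /= [He /point_order_large/ltnW le_N].
  rewrite /dvdn /d -modnDml He -(padic_residue_le e0 le_N) modnDml subnKC ?residue_le //.
  by rewrite -(subnKC le_N) expnD modnMr.
have e00 : evK (one_plus_T_pow e0) != 0.
  rewrite -(rmorph0 evK) (inj_eq evK_inj); apply/eqP => /(congr1 (fun g => coefps g 0)).
  rewrite coefps0 /=; have := padic_int_binom_fact e0 0; rewrite big_ord0 fact0 mul1r => ->.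
  by move/eqP; rewrite oner_eq0.
have Y_alg : alg (cls Y).
  have -> : cls Y = cls (fun i => z i ^+ e i) / evK (one_plus_T_pow e0).
    apply: (mulIf e00); rewrite divfK // evKE -rmorphM; apply/cls_eq.
    by apply: filterS XY => i /= ->.
  by apply: algebraic_div => //; apply: alg_ev.
have [Q Q0 QY] := proj1 (alg_family Y) Y_alg.
have [l [w Hlw]] := point_root k0 Q0.
(* [point_root] excludes the second case. In the first, [Y] takes its values among finitely many
   roots of unity, so it is constant on a set of [U]. *)
have [Ul|Ul] := in_ultra_setVsetC [set i | Y i ^+ (p ^ l) = 1] HU; last first.
  have [i [/= [Hl Hd] HQ]] := filter_ex (filterI (filterI Ul (d_dvd w)) QY).
  case/eqP: (Hlw _ _ _ _ (Ez i) Hd (introN eqP Hl)).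
  exact: HQ.
have [rs Ers] := closed_field_poly_normal ('X^(p ^ l) - 1 : {poly C}).
rewrite lead_coefXnsubC // scale1r in Ers.
have Yrs i : Y i ^+ (p ^ l) = 1 -> Y i \in rs.
  by move=> Yi; rewrite -root_prod_XsubC -Ers rootE hornerD hornerN hornerC hornerXn Yi subrr.
have [|v Hv] := ultra_finite HU (m := size rs) (h := fun i => index (Y i) rs).
  by apply: filterS Ul => i /= /Yrs; rewrite index_mem.
have eta_eq : U [set i | Y i = nth 0 rs v].
  by apply: filterS (filterI Ul Hv) => i /= [/Yrs Yi <-]; rewrite nth_index.
exists (nth 0 rs v), e0; split; first exists l.
  by have [i [/= Yi <-]] := filter_ex (filterI Ul eta_eq).
by apply: filterS (filterI XY eta_eq) => i /= [-> ->].
Qed.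

Section Conclusion.
Variables (B : nat) (xi : C) (m0 : nat) (xi_prim : m0.-primitive_root xi).
Variables (c : 'I_B -> {poly int}) (e : nat -> 'I_B -> nat) (F : nat -> C).
Local Notation cv := (fun j => (map_poly intr (c j)).[xi] : C).
Hypothesis F_sum : forall i, F i = \sum_j cv j * z i ^+ e i j.
Variables (Q : {poly L0}) (Q0 : Q != 0).
Hypothesis QF : forall i, (map_poly (E i) Q).[F i] = 0.

(** At each point the relation [Q (F) = 0] is an equation over [Q_p] in a root of unity [th]. Its
    conjugate says that the power sum is a root of the polynomial obtained by applying [ps_pow a] to
    the coefficients of [Q], nonzero because [a] is. *)
Lemma conj_sum_alg : exists d, forall m,
  alg (cls (fun i => \sum_j cv j * z i ^+ e i j ^+ (1 + p ^ d * m))).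
Proof.
have [d Hd] := unity_conj_AP k0_alg xi_prim; exists d => m; set a := (1 + _)%N.
apply/alg_family; exists (\poly_(j < size Q) ps_pow a Q`_j).
  rewrite -lead_coef_eq0 lead_coef_poly ?size_poly_gt0 //.
    by rewrite ps_pow_neq0 ?lead_coef_eq0 // padic_nat_neq0.
  by rewrite ps_pow_neq0 -?lead_coefE ?lead_coef_eq0 // padic_nat_neq0.
apply: filterS (z_large 0) => i /=; rewrite expn0 expr1 => z1.
have [l zl zl1] := order_exists (point_unity (Ez i)) z1.
have [th [u [v [thu thv]]]] := Hd l (z i) zl zl1.
move=> /(_ m)[w [w_conj wu wv]].
pose r j := sval (cid (point_pow k0_alg (Ez i) z1 a Q`_j)).
have rP j : E i Q`_j = (map_poly k (r j)).[z i - 1] /\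
    E i (ps_pow a Q`_j) = (map_poly k (r j)).[z i ^+ a - 1].
  by rewrite /r; case: cid.
pose rr j : {poly (padic p_pr)} := map_poly (@tofrac Zp) (r j).
have rrE j : map_poly k0 (rr j) = map_poly k (r j) by rewrite -map_poly_comp.
pose cc j : {poly (padic p_pr)} := map_poly intr (c j).
have ccE j : map_poly k0 (cc j) = map_poly intr (c j).
  by rewrite -map_poly_comp; apply: eq_map_poly => y /=; rewrite rmorph_int.
pose R := relation_poly (size Q) u v rr cc (e i).
have Rth : root (map_poly k0 R) th.
  rewrite rootE relation_polyE thu thv; apply/eqP; rewrite -[RHS](QF i).
  rewrite (@horner_coef_wide _ (size Q)) ?size_poly //; apply: eq_bigr => j _.
  rewrite coef_map /= (rP j).1 rrE F_sum; congr (_ * _ ^+ _).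
  by apply: eq_bigr => j' _; rewrite ccE.
have /rootP := w_conj R Rth; rewrite relation_polyE wu wv => E0.
rewrite -[RHS]E0 (@horner_coef_wide _ (size Q)); last first.
  by apply: leq_trans (size_poly _ _) _; apply: size_poly.
apply: eq_bigr => j _; rewrite coef_map coef_poly ltn_ord /= (rP j).2 rrE.
congr (_ * _ ^+ _); apply: eq_bigr => j' _.
by rewrite ccE exprAC.
Qed.

(** Indices with the same [y] form groups, and those of zero sum drop out. Prony's method says
    nothing about their [y], so they have to be removed. *)
Lemma zero_groups_sum (y g : 'I_B -> KK) :
  \sum_i g i = \sum_(i | \sum_(j | y j == y i) g j != 0) g i.
Proof.
rewrite (bigID (fun i => \sum_(j | y j == y i) g j != 0)) /= [X in _ + X](_ : _ = 0) ?addr0 //.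
pose rep i := odflt i [pick j | y j == y i].
have repP i : y (rep i) = y i.
  by rewrite /rep; case: pickP => [j /eqP//|/(_ i)]; rewrite eqxx.
have repE i j : y i = y j -> rep i = rep j.
  move=> Eij; rewrite /rep; have -> : [pick j' | y j' == y i] = [pick j' | y j' == y j].
    by apply: eq_pick => j' /=; rewrite Eij.
  by case: pickP => // /(_ j); rewrite eqxx.
rewrite (partition_big rep predT) //= big1 // => r _.
have [i0 /andP[Gi0 /eqP ri0]|none] := pickP (fun i => ~~ (\sum_(j | y j == y i) g j != 0) && (rep i == r)); last first.
  by rewrite big_pred0.
move: Gi0; rewrite negbK => /eqP Gi0; rewrite -[RHS]Gi0; apply: eq_bigl => i.
apply/andP/eqP => [[_ /eqP ri]|yi]; first by rewrite -repP ri -ri0 repP.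
split; last by rewrite (repE _ _ yi) ri0.
by rewrite negbK yi Gi0.
Qed.

Theorem core_sum : exists (eta : 'I_B -> C) (e0 : 'I_B -> Zp),
  (forall j, eta j = 0 \/ exists L, eta j ^+ (p ^ L) = 1) /\
  U [set i | F i = \sum_j cv j * eta j * E i (one_plus_T_pow (e0 j))].
Proof.
have [d Hd] := conj_sum_alg.
pose X j := cls (fun i => z i ^+ e i j); pose y j := X j ^+ (p ^ d).
pose cst j := cls (fun _ => cv j); pose g j := cst j * X j.
have pd_gt0 : (0 < p ^ d)%N by rewrite expn_gt0 prime_gt0.
have u_alg m : alg (\sum_j g j * y j ^+ m).
  have -> // : \sum_j g j * y j ^+ m = cls (fun i => \sum_j cv j * z i ^+ e i j ^+ (1 + p ^ d * m)).
  transitivity (cls (\sum_j (fun _ => cv j) * (fun i => z i ^+ e i j) ^+ (1 + p ^ d * m))).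
    rewrite rmorph_sum; apply: eq_bigr => j _; rewrite rmorphM rmorphXn /g -/(cst j) -/(X j) -mulrA.
    by rewrite /y -exprM -exprS.
  apply: (congr1 cls); apply/funext => i; rewrite fct_sumE; apply: eq_bigr => j _.
  by congr (_ * _); rewrite fctX.
have good j : \sum_(i | y i == y j) g i != 0 -> exists (eta : C) (e0 : Zp),
    (exists L, eta ^+ (p ^ L) = 1) /\ U [set i | z i ^+ e i j = eta * E i (one_plus_T_pow e0)].
  move=> Gj; apply: alg_unity; apply: (algebraic_root_exp pd_gt0).
  exact: (prony u_alg Gj).
have Hj j : exists ee : C * Zp, (ee.1 = 0 \/ exists L, ee.1 ^+ (p ^ L) = 1) /\
    (if \sum_(i | y i == y j) g i != 0 then X j = cls (fun=> ee.1) * evK (one_plus_T_pow ee.2)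
     else ee.1 = 0).
  (* The value [0] of [eta] erases a term whose group has zero sum. *)
  case G : (\sum_(i | y i == y j) g i != 0); last by exists (0, 0); split=> //; left.
  have [eta [e0 [HL HU']]] := good j G; exists (eta, e0); split; first by right.
  by rewrite evKE -rmorphM; apply/cls_eq; apply: filterS HU' => i /= ->.
pose ee j := sval (cid (Hj j)).
have eeP j : ((ee j).1 = 0 \/ exists L, (ee j).1 ^+ (p ^ L) = 1) /\
    (if \sum_(i | y i == y j) g i != 0 then X j = cls (fun=> (ee j).1) * evK (one_plus_T_pow (ee j).2)
     else (ee j).1 = 0).
  by rewrite /ee; case: cid.
exists (fun j => (ee j).1), (fun j => (ee j).2); split=> [j|]; first by case: (eeP j).
apply/cls_eq; transitivity (\sum_j g j).
  transitivity (cls (\sum_j (fun _ => cv j) * (fun i => z i ^+ e i j))).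
    by apply: (congr1 cls); apply/funext => i; rewrite fct_sumE F_sum.
  by rewrite rmorph_sum; apply: eq_bigr => j _; rewrite rmorphM.
rewrite (zero_groups_sum y) big_mkcond /=.
transitivity (cls (\sum_j (fun _ => cv j) * (fun _ => (ee j).1) * point_family (one_plus_T_pow (ee j).2))); last first.
  by apply: (congr1 cls); apply/funext => i; rewrite fct_sumE.
rewrite rmorph_sum; apply: eq_bigr => j _; rewrite !rmorphM -/(cst j) -/(evK _).
case: (eeP j) => _; case: ifP => _ Hx; first by rewrite /g Hx mulrA.
rewrite Hx [X in _ * X * _](_ : _ = 0) ?mulr0 ?mul0r //.
by apply/cls0; apply: filterS filterT.
Qed.

End Conclusion.

End Core.

(** * Transfer of the identity to [Omega] *)

(** [th] has no image in [Omega], so it is eliminated: the resultant of [X ^ N - 1] and of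
    [F - \sum_i D_i(X) w_i], made monic, lies in [A] and vanishes under every good [P], hence under
    [j], which yields a common root [x] in [Omega]. *)
Lemma root_of_unity_transfer (A : comNzRingType) (C Omega : closedFieldType)
    (j : {rmorphism A -> Omega}) (good : {rmorphism A -> C} -> Prop)
    (B N : nat) (D : 'I_B -> {poly int}) (th : C) (F : A) (w : 'I_B -> A) :
    (forall a, (forall P : {rmorphism A -> C}, good P -> P a = 0) -> j a = 0) ->
    (0 < N)%N -> th ^+ N = 1 ->
    (forall P : {rmorphism A -> C}, good P ->
       P F = \sum_i (map_poly intr (D i)).[th] * P (w i)) ->
  exists2 x : Omega, x ^+ N = 1 & j F = \sum_i (map_poly intr (D i)).[x] * j (w i).
Proof.
move=> dense N_gt0 thN PF.
pose G : {poly A} := F%:P - \sum_i map_poly intr (D i) * (w i)%:P.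
(* Adding a multiple of [q1] to [G] makes it monic without changing its values at [N]-th roots of
   unity. *)
pose q1 : {poly A} := 'X^N - 1; pose q2 : {poly A} := 'X^(size G) * q1 + G.
have GE (R : comNzRingType) (phi : {rmorphism A -> R}) x :
    (map_poly phi G).[x] = phi F - \sum_i (map_poly intr (D i)).[x] * phi (w i).
  rewrite /G rmorphB /= map_polyC hornerD hornerN hornerC rmorph_sum horner_sum.
  congr (_ - _); apply: eq_bigr => i _; rewrite rmorphM /= map_polyC hornerM hornerC.
  congr (_.[_] * _); rewrite -map_poly_comp; apply: eq_map_poly => m /=.
  by rewrite rmorph_int.
have q1E (R : comNzRingType) (phi : {rmorphism A -> R}) x : (map_poly phi q1).[x] = x ^+ N - 1.
  by rewrite /q1 rmorphB /= map_polyXn rmorph1 hornerD hornerN hornerC hornerXn.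
have q2E (R : comNzRingType) (phi : {rmorphism A -> R}) x :
    (map_poly phi q2).[x] = x ^+ (size G) * (x ^+ N - 1) + (map_poly phi G).[x].
  by rewrite /q2 rmorphD rmorphM /= hornerD hornerM q1E map_polyXn hornerXn.
have q1_mon : q1 \is monic by rewrite /q1 -polyC1 monicXnsubC.
have sq1 : size q1 = N.+1 by rewrite /q1 -polyC1 size_XnsubC.
have sXq : size ('X^(size G) * q1) = (size G + N).+1.
  by rewrite size_monicM ?monicXn ?monic_neq0 // size_polyXn sq1 addSn addnS.
have lt_s : (size G < size ('X^(size G) * q1)%R)%N by rewrite sXq ltnS leq_addr.
have q2_mon : q2 \is monic by rewrite /q2 monicE lead_coefDl // -monicE monicMl ?monicXn.
have q2_gt1 : (1 < size q2)%N by rewrite /q2 size_polyDl // sXq ltnS addn_gt0 N_gt0 orbT.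
have q1_gt1 : (1 < size q1)%N by rewrite sq1.
have /(elim_res_common q1_mon q2_mon)[x []] : j (elim_res q1 q2) = 0.
  apply: dense => P Pg; apply: (elim_res_root q1_gt1 q2_gt1 (y := th)).
    by rewrite rootE q1E thN subrr.
  by rewrite rootE q2E thN subrr mulr0 add0r GE (PF P Pg) subrr.
rewrite rootE q1E subr_eq0 => /eqP xN; rewrite rootE q2E xN subrr mulr0 add0r GE subr_eq0 => /eqP jF.
by exists x.
Qed.

Lemma unity_exprz_nat (C : fieldType) (x : C) N (e : int) :
  (0 < N)%N -> x ^+ N = 1 -> exists m : nat, x ^ e = x ^+ m.
Proof.
move=> N_gt0 xN; case: e => m; first by exists m.
exists (N.-1 * m.+1)%N; rewrite NegzE -exprnN exprM.
have x0 : x != 0 by apply/eqP => x0; move/esym/eqP: xN; rewrite x0 expr0n gtn_eqF // oner_eq0.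
apply: (mulIf (expf_neq0 m.+1 x0)); rewrite mulVf ?expf_neq0 //.
by rewrite -exprMn -exprSr prednK // xN expr1n.
Qed.

Lemma infinite_unity_sequence (C : closedFieldType) (S : set C) : infinite_set S ->
  exists2 z : nat -> C, forall i, S (z i) &
    forall m, (0 < m)%N -> \oo [set i | z i ^+ m != 1].
Proof.
move=> /infiniteP/card_leP[h]; pose f i := val (h (exist _ i (in_setT i))).
exists f => [i|m m_gt0]; first exact: set_valP.
have f_inj : injective f.
  by move=> i i' /val_inj/(@inj _ _ _ h); rewrite !in_setT => /(_ isT isT) [].
have [rs Ers] := closed_field_poly_normal ('X^m - 1 : {poly C}).
rewrite -polyC1 lead_coefXnsubC // scale1r polyC1 in Ers.
have [M HM] : exists M, forall i, (M <= i)%N -> f i \notin rs.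
  elim: rs {Ers} => [|r rs [M HM]]; first by exists 0%N.
  have [[i0 fi0]|none] := pselect (exists i, f i = r).
    exists (maxn M i0.+1) => i; rewrite geq_max => /andP[/HM Hi lt_i].
    by rewrite inE negb_or Hi andbT -fi0 (inj_eq f_inj) gtn_eqF.
  exists M => i /HM Hi; rewrite inE negb_or Hi andbT.
  by apply/eqP => fi; apply: none; exists i.
exists M => // i /= /HM; apply: contraNneq => fi.
by rewrite -root_prod_XsubC -Ers rootE hornerD hornerN hornerC hornerXn fi subrr.
Qed.

Theorem theorem4p12 (p : nat) (p_pr : prime p)
    (K : fieldExtType (padic p_pr))
    (Qpbar : closedFieldType) (iota : {rmorphism K -> Qpbar})
    (Qpbar_closure : algebraic_closure (iota \o in_alg K))
    (L : fieldExtType {fraction Lambda K})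
    (Omega : closedFieldType) (j : {rmorphism L -> Omega})
    (Omega_closure : algebraic_closure j)
    (F : iclosure_Lambda L) (B : nat)
    (S : set Qpbar) (S_mu : S `<=` p_power_roots_of_unity p Qpbar)
    (S_infinite : infinite_set S)
    (P : S -> {rmorphism iclosure_Lambda L -> Qpbar})
    (P_ext : forall zeta : S, extends_point iota (P zeta) (val zeta - 1))
    (xi : Qpbar) (xi_root : is_root_of_unity xi)
    (c : 'I_B -> Qpbar) (c_int : forall i, Zadjoin xi (c i))
    (F_int : forall zeta : S, Zadjoin2 xi (val zeta) (P zeta F))
    (F_sum : forall zeta : S, exists e : 'I_B -> int,
       P zeta F = \sum_(i < B) c i * val zeta ^ e i) :
  exists (xi' : Omega) (d : 'I_B -> Omega) (e : 'I_B -> padic_int p_pr),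
    [/\ is_root_of_unity xi',
        forall i, Zadjoin xi' (d i),
        adjoin1 (j \o frac_alg L) xi' (j (val F)) &
        j (val F) = \sum_(i < B) d i * j (frac_alg L (Lambda_pow K (e i)))].
Proof.
pose k0 : {rmorphism padic p_pr -> Qpbar} := base_emb iota.
have k0_alg x : algebraicOver k0 x := Qpbar_closure x.
have [z0 z0S z0_large] := infinite_unity_sequence S_infinite.
pose zeta i : S := exist _ (z0 i) (mem_set (z0S i)).
have zN i : exists m, z0 i ^+ (p ^ m) = 1.
  by have [m /unity_rootP zm] := S_mu _ (z0S i); exists m.
pose n i := sval (cid (zN i)); have zn i : z0 i ^+ (p ^ n i) = 1 by rewrite /n; case: cid.
have pX_gt0 m : (0 < p ^ m)%N by rewrite expn_gt0 prime_gt0.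
pose inM : {rmorphism power_series (padic_int p_pr) -> iclosure_Lambda L} :=
  (ic_in (frac_alg L) \o ps_emb K : {rmorphism power_series (padic_int p_pr) -> iclosure_Lambda L}).
pose E i : {rmorphism power_series (padic_int p_pr) -> Qpbar} :=
  (P (zeta i) \o inM : {rmorphism power_series (padic_int p_pr) -> Qpbar}).
have Ez i : is_point k0 (E i) (z0 i) (n i).
  have [Pc Pv] := P_ext (zeta i); split=> // [a|].
    rewrite -[RHS]/(iota (val (ic_in (frac_alg K) a))) -Pc; congr (P _ (ic_in _ _)).
    by apply: power_seriesP => -[|m] //=; rewrite rmorph0.
  rewrite -[RHS]Pv; congr (P _ (ic_in _ _)).
  by apply: power_seriesP => m /=; rewrite rmorph_nat.
have [U [HU ooU]] := ultraFilterLemma eventually_filter.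
have z_large l : U [set i | z0 i ^+ (p ^ l) != 1] by apply/ooU/z0_large.
have [KK [cls cls0]] := ultraproduct_exists Qpbar HU.
have [m1 m1_gt0 /unity_rootP xim1] := xi_root.
have [m0 xi_prim _] := prim_order_exists m1_gt0 xim1.
pose Cp i := sval (cid (c_int i)).
have CpE i : c i = (map_poly intr (Cp i)).[xi] by rewrite /Cp; case: cid.
have eN i : exists e : 'I_B -> nat, P (zeta i) F = \sum_s c s * z0 i ^+ e s.
  have [e ->] := F_sum (zeta i).
  pose e' s := sval (cid (unity_exprz_nat (e s) (pX_gt0 (n i)) (zn i))).
  exists e'; apply: eq_bigr => s _; congr (_ * _).
  by rewrite /e'; case: cid.
pose e i := sval (cid (eN i)).
have eE i : P (zeta i) F = \sum_s (map_poly intr (Cp s)).[xi] * z0 i ^+ e i s.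
  by rewrite /e; case: cid => e' /= ->; apply: eq_bigr => s _; rewrite CpE.
have [Q Q0 QF] := iclosure_algebraic iota F.
have QFi i : (map_poly (E i) Q).[P (zeta i) F] = 0.
  by rewrite map_poly_comp horner_map (rootP QF) rmorph0.
have [eta [e0 [eta_root UF]]] := core_sum k0_alg HU Ez z_large cls0 xi_prim eE Q0 QFi.
have HL s : exists l, eta s = 0 \/ eta s ^+ (p ^ l) = 1.
  by case: (eta_root s) => [->|[l Hl]]; [exists 0%N; left | exists l; right].
(* [N] is such that [xi] and all the nonzero [eta s] are powers of one root of unity [th] of order
   [N]. *)
pose Ls s := sval (cid (HL s)); pose N := (p ^ (\sum_s Ls s) * m0)%N.
have N_gt0 : (0 < N)%N by rewrite muln_gt0 pX_gt0 (prim_order_gt0 xi_prim).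
have [|th th_prim] := @prim_root_exists Qpbar N N_gt0; first by rewrite (char_closure k0) -lt0n.
have [v Ev] : exists v, xi = th ^+ v.
  have [|[v _] /= Ev] := prim_rootP th_prim (_ : xi ^+ N = 1); last by exists v.
  by rewrite /N mulnC exprM (prim_expr_order xi_prim) expr1n.
have HD s : exists D : {poly int}, (map_poly intr D).[th] = (map_poly intr (Cp s)).[xi] * eta s.
  have : eta s = 0 \/ eta s ^+ (p ^ Ls s) = 1 by rewrite /Ls; case: cid.
  case=> [->|Es]; first by exists 0; rewrite rmorph0 horner0 mulr0.
  have [|[w _] /= Ew] := prim_rootP th_prim (_ : eta s ^+ N = 1).
    by rewrite /N (bigD1 s) //= expnD -mulnA exprM Es expr1n.
  exists ((Cp s \Po 'X^v) * 'X^w).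
  by rewrite rmorphM /= map_comp_poly !map_polyXn hornerM horner_comp !hornerXn -Ev -Ew.
pose D s := sval (cid (HD s)).
have DE s : (map_poly intr (D s)).[th] = (map_poly intr (Cp s)).[xi] * eta s.
  by rewrite /D; case: cid.
pose jM : {rmorphism iclosure_Lambda L -> Omega} := (j \o val : {rmorphism iclosure_Lambda L -> Omega}).
pose wM s : iclosure_Lambda L := inM (one_plus_T_pow (e0 s)).
(* The identity is known on a set of [U] only; this is enough, as such a set contains points of
   arbitrarily large order. *)
pose good (R : {rmorphism iclosure_Lambda L -> Qpbar}) := exists2 i,
  R = P (zeta i) & P (zeta i) F = \sum_s (map_poly intr (Cp s)).[xi] * eta s * E i (one_plus_T_pow (e0 s)).
have [a a_good|R [i -> ->]|x xN jF] :=
    @root_of_unity_transfer _ _ _ jM good B N D th F wM _ N_gt0 (prim_expr_order th_prim) _.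
- suff -> : a = 0 by rewrite rmorph0.
  (* If [P a = 0], an equation of [a] with nonzero constant term forces this constant term to vanish
     at the point. *)
  apply/eqP; apply: contraT => a0; have [q q0 qa] := iclosure_algebraic_const iota a0.
  have [l Hl] := point_neq0 k0 q0.
  have [i [Hi zi]] := filter_ex (filterI UF (z_large l)).
  have /eqP[] := Hl _ _ _ (Ez i) zi.
  have Pa : P (zeta i) a = 0 by apply: a_good; exists i.
  have := congr1 (P (zeta i)) (rootP qa); rewrite -horner_map Pa rmorph0 -map_poly_comp.
  by rewrite horner_coef0 coef_map.
- by apply: eq_bigr => s _; rewrite DE.
exists x, (fun s => (map_poly intr (D s)).[x]), e0; split=> //.
- by exists N => //; apply/unity_rootP.
- by move=> s; exists (D s).
exists (\sum_s map_poly intr (D s) * (Lambda_pow K (e0 s))%:P).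
rewrite -[LHS]/(jM F) jF rmorph_sum horner_sum; apply: eq_bigr => s _.
rewrite rmorphM /= map_polyC hornerM hornerC; congr (_.[_] * _).
rewrite -map_poly_comp; apply: eq_map_poly => m.
by rewrite -[RHS]/(j (frac_alg L m%:~R)) !rmorph_int.
Qed.
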